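(* The map $\Theta:\mathbf{O}_N\to\mathbf{Arc}_N$ defined by $\Theta(\mathsf{e}_\sigma)=A_\sigma$ for $\sigma\in\mathfrak{S}_N$ is a monoid isomorphism from the Okada monoid $\mathbf{O}_N$ to the monoid $\mathbf{Arc}_N$ of rank $N$ Okada arc-diagrams, and it sends $\mathsf{e}_i$ to $A_i$ for $1\le i\le N-1$.
   Context: Okada monoid: $\mathbf{O}_N$ is the monoid generated by $\mathsf{e}_1,\dots,\mathsf{e}_{N-1}$ with relations $\mathsf{e}_i^2=\mathsf{e}_i$, $\mathsf{e}_i\mathsf{e}_j=\mathsf{e}_j\mathsf{e}_i$ ($|i-j|\ge 2$), $\mathsf{e}_{i+1}\mathsf{e}_i\mathsf{e}_{i+1}=\mathsf{e}_{i+1}$ ($1\le i\le N-2$). Okada arc-diagrams: let $[N]=\{1,\dots,N\}$, $\overline{[N]}=\{\bar1,\dots,\bar N\}$, $|i|=|\bar i|=i$, ordered by $1<\dots<N<\bar N<\dots<\bar1$. A non-crossing arc-diagram of rank $N$ is a perfect matching of $[N]\cup\overline{[N]}$ (pairs are called arcs) with no arcs $\{a,b\},\{c,d\}$ with $a<c<b<d$. Arc $\{a,b\}$ ($a<b$) is nested in $\{c,d\}$ ($c<d$) if $c<a<b<d$. An Okada arc-diagram is a non-crossing arc-diagram whose arcs carry integer labels such that: (1) the label of $\{a,b\}$ lies between $1$ and $\min(|a|,|b|)$; (2) it has the same parity as $\min(|a|,|b|)$; (3) an arc nested in another has a strictly larger label. The product $C\cdot D$ is obtained by identifying each node $\bar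 i$ of $C$ with node $i$ of $D$, concatenating arcs, discarding closed loops, and labelling each resulting arc by the minimum of the labels of the arcs of $C$ and $D$ composing it. This makes the set $\mathbf{Arc}_N$ of rank $N$ Okada arc-diagrams a monoid with identity the diagram with arcs $\{a,\bar a\}$ labelled $a$. Generators: $A_i$ ($1\le i<N$) is the Okada arc-diagram with arcs $\{a,\bar a\}$ labelled $a$ for $a\ne i,i+1$, and arcs $\{i,i+1\}$ and $\{\bar i,\overline{i+1}\}$ both labelled $i$. The code of $\sigma\in\mathfrak{S}_N$ is $(c_1,\dots,c_N)$, $c_i=\#\{k<i:\sigma^{-1}(k)>\sigma^{-1}(i)\}$. For $g_i=\mathsf{e}_i$ or $g_i=A_i$, set $g_\sigma=\prod_{i=1}^N (g_{i-1}g_{i-2}\cdots g_{i-c_i})$, factors ordered with $i$ increasing from left to right; this defines $\mathsf{e}_\sigma$ and $A_\sigma$. The map $\sigma\mapsto\mathsf{e}_\sigma$ is a bijection $\mathfrak{S}_N\to\mathbf{O}_N$. *)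

(* Defs.v *)
Set Warnings "-notation-overridden".
From HB Require Import structures.
From mathcomp Require Import fingroup perm all_boot.
From mathcomp Require Import zify.
From mathcomp Require Import boolp.

Set Implicit Arguments.
Unset Strict Implicit.
Unset Printing Implicit Defensive.

Local Open Scope nat_scope.

(* Indices are 0-based: (false, i) stands for the node i+1 and (true, i) for
   the barred node of i+1. *)
Definition node (N : nat) := (bool * 'I_N)%type.

(* Rank in the order 1 < ... < N < bar N < ... < bar 1, counted from 0. *)
Definition pos N (x : node N) : nat := if x.1 then N.*2 - x.2.+1 else x.2.

(* |x|, which is 1-based. *)
Definition absn N (x : node N) : nat := x.2.+1.

(* A perfect matching is encoded by a fixed-point-free involution of the nodes,
   and the label of an arc is carried by both of its endpoints. *)
Definition prediag (N : nat) :=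
  ({ffun node N -> node N} * {ffun node N -> nat})%type.

Definition mate N (C : prediag N) : node N -> node N := C.1.
Definition lab N (C : prediag N) : node N -> nat := C.2.

Definition matching N (C : prediag N) : bool :=
  [forall x, (mate C (mate C x) == x) && (mate C x != x)].

(* Arcs {a, b}, {c, d} with a < c < b < d are met as x = a, y = c. *)
Definition noncrossing N (C : prediag N) : bool :=
  [forall x, forall y,
     ~~ [&& pos x < pos y, pos y < pos (mate C x)
          & pos (mate C x) < pos (mate C y)]].

(* The arc with smaller endpoint x is nested in the arc with smaller endpoint y. *)
Definition nested N (C : prediag N) (x y : node N) : bool :=
  [&& pos y < pos x, pos x < pos (mate C x) & pos (mate C x) < pos (mate C y)].

(* Natural numbers suffice for the labels, which are all at least 1. *)
Definition well_labelled N (C : prediag N) : bool :=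
  [forall x, let m := minn (absn x) (absn (mate C x)) in
     [&& lab C (mate C x) == lab C x, 1 <= lab C x <= m
       & odd (lab C x) == odd m]]
  && [forall x, forall y, nested C x y ==> (lab C y < lab C x)].

Definition okada_arc N (C : prediag N) : bool :=
  [&& matching C, noncrossing C & well_labelled C].

(* Product of C (left summand) and D (right summand): the node bar i of C is
   linked to the node i of D, and two outer nodes are matched when a path of
   arcs and links joins them.  Closed loops meet no outer node, hence they play
   no role. *)
Section Stack.
Variables (N : nat) (C D : prediag N).
Implicit Types (z t : node N + node N).

Definition strand z : node N + node N :=
  match z with inl x => inl (mate C x) | inr x => inr (mate D x) end.

Definition glue z : node N + node N :=
  match z with
  | inl (true, i) => inr (false, i)
  | inr (false, i) => inl (true, i)
  | _ => z
  end.

Definition stack_lab z : nat :=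
  match z with inl x => lab C x | inr x => lab D x end.

Definition outer (x : node N) : node N + node N :=
  if x.1 then inr x else inl x.

Definition stacked : rel (node N + node N) :=
  [rel z t | (t == strand z) || (t == glue z)].

Definition diag_mul : prediag N :=
  ([ffun x => odflt x
      [pick y | (y != x) && connect stacked (outer x) (outer y)]],
   [ffun x => \big[minn/stack_lab (outer x)]_(z | connect stacked (outer x) z)
      stack_lab z]).
End Stack.

Lemma connect_ind (T : finType) (e : rel T) (P : T -> Prop) x :
  P x -> (forall y z, P y -> e y z -> P z) -> forall z, connect e x z -> P z.
Proof.
move=> Px Pe z /connectP[p]; elim: p x Px => [|y p IH] x Px /=.
  by move=> _ ->.
by move=> /andP[xy py] lz; exact: IH (Pe _ _ Px xy) py lz.
Qed.

Section Zigzag.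
Variables (T : finType) (f g : T -> T).
Hypotheses (fK : involutive f) (gK : involutive g) (fN : forall x, f x != x).

Definition zedge : rel T := [rel z t | (t == f z) || (t == g z)].

Lemma zedge_sym : symmetric zedge.
Proof.
by move=> x y; apply/idP/idP => /orP[] /eqP ->; apply/orP;
  [left | right | left | right]; apply/eqP; rewrite ?fK ?gK.
Qed.

Lemma zconnect_sym x y : connect zedge x y = connect zedge y x.
Proof. exact: (sym_connect_sym zedge_sym). Qed.

Lemma zconnect_f x y : connect zedge x y -> connect zedge x (f y).
Proof. by move/connect_trans; apply; apply: connect1; rewrite /zedge /= eqxx. Qed.

Lemma zconnect_g x y : connect zedge x y -> connect zedge x (g y).
Proof. by move/connect_trans; apply; apply: connect1; rewrite /zedge /= eqxx orbT. Qed.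

(* A component of the graph spanned by two involutions f and g, with f free of
   fixed points, has zero or two fixed points of g. *)
Lemma zigzag x : g x = x ->
  exists y, [/\ y != x, g y = y, connect zedge x y
    & forall z, connect zedge x z -> g z = z -> z = x \/ z = y].
Proof.
move=> gx; pose h z := f (g z).
have hI : injective h by apply: inj_comp; exact: inv_inj.
set n := order h x.
have hn : iter n h x = x by exact: iter_order.
have hinj i j : i < n -> j < n -> iter i h x = iter j h x -> i = j.
  by move=> iltn jltn E; rewrite -(findex_iter iltn) E findex_iter.
have n0 : 0 < n by exact: order_gt0.
have gh k : k <= n -> g (iter k h x) = iter (n - k) h x.
  elim: k => [|k IH] kn; first by rewrite subn0 /= gx hn.
  apply: hI; rewrite /= {1 2}/h gK fK IH; last exact: ltnW.
  by rewrite -/(h _) -iterS subnSK.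
have fh k : k <= n -> f (iter k h x) = iter (n - k).+1 h x.
  by move=> kn; rewrite iterS -gh // /h gK.
have ev : ~~ odd n.
  apply/negP => on; have := fN (iter (n./2).+1 h x).
  have E := odd_double_half n; rewrite on /= in E.
  rewrite fh; last by lia.
  suff -> : (n - n./2.+1).+1 = n./2.+1 by rewrite eqxx.
  lia.
have E := odd_double_half n; rewrite (negPf ev) /= add0n in E.
have cE z : connect zedge x z -> exists2 k, k < n & z = iter k h x.
  move: z; apply: connect_ind; first by exists 0.
  have mk k : exists2 k', k' < n & iter k h x = iter k' h x.
    have : fconnect h x (iter k h x) by exact: fconnect_iter.
    move=> H; exists (findex h x (iter k h x)); first exact: findex_max.
    by rewrite iter_findex.
  move=> y z [k kn ->] /orP[] /eqP ->.
    by rewrite fh ?(ltnW kn).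
  by rewrite gh ?(ltnW kn).
exists (iter n./2 h x); split.
- by apply/eqP => H; have E2 : n./2 = 0 by [apply: (hinj _ 0 _ _ H); lia]; lia.
- by rewrite gh; [congr (iter _ _ _); lia | lia].
- elim: n./2 => [|k IH] //=.
  by rewrite /h; apply: zconnect_f; exact: zconnect_g.
move=> z /cE[k kn ->]; rewrite gh ?(ltnW kn) // => H.
case: k kn H => [|k] kn H; [by left | right].
have E2 : n - k.+1 = k.+1 by apply: (hinj _ _ _ _ H); lia.
by have -> : n./2 = k.+1 by lia.
Qed.
End Zigzag.

Lemma matchingP N (C : prediag N) :
  reflect (involutive (mate C) /\ forall x, mate C x != x) (matching C).
Proof.
apply: (iffP forallP) => [H|[H1 H2] x]; last by rewrite H1 eqxx H2.
by split=> x; case/andP: (H x) => [/eqP].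
Qed.

Section StackTheory.
Variables (N : nat) (C D : prediag N).
Hypotheses (mC : matching C) (mD : matching D).

Lemma strandK : involutive (strand C D).
Proof.
case/matchingP: mC => CK _; case/matchingP: mD => DK _.
by case=> x /=; rewrite ?CK ?DK.
Qed.

Lemma strandN z : strand C D z != z.
Proof.
case/matchingP: mC => _ CN; case/matchingP: mD => _ DN.
case: z => x /=; apply/eqP => -[] H; first by have /eqP := CN x.
by have /eqP := DN x.
Qed.

Lemma glueK : involutive (@glue N).
Proof. by case=> [[[] i]|[[] i]]. Qed.

Lemma glue_outer x : glue (outer x) = outer x :> node N + node N.
Proof. by case: x => [[] i]. Qed.

Lemma outer_inj : injective (@outer N).
Proof. by move=> [[] i] [[] j] // [->]. Qed.

Lemma glue_fix z : glue z = z -> exists x : node N, z = outer x.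
Proof.
by case: z => [[[] i]|[[] i]] //= _; [exists (false, i)|exists (true, i)].
Qed.

Let conn := connect (stacked C D).

Lemma conn_sym x y : conn x y = conn y x.
Proof. exact: zconnect_sym strandK glueK _ _. Qed.

Lemma conn_strand x y : conn x y -> conn x (strand C D y).
Proof. exact: zconnect_f. Qed.

Lemma conn_glue x y : conn x y -> conn x (glue y).
Proof. exact: zconnect_g. Qed.

Lemma diag_mul_mateP x :
  [/\ mate (diag_mul C D) x != x, conn (outer x) (outer (mate (diag_mul C D) x))
    & forall y, y != x -> conn (outer x) (outer y) -> y = mate (diag_mul C D) x].
Proof.
have [z [zx /glue_fix[y Ey] xz U]] :=
  zigzag strandK glueK strandN (glue_outer x).
subst z; rewrite /mate /= ffunE.
have yx : y != x by apply: contraNneq zx => ->.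
have U' t : t != x -> conn (outer x) (outer t) -> t = y.
  move=> tx xt; have [] := U _ xt (glue_outer t).
    by move/outer_inj=> E; rewrite E eqxx in tx.
  exact: outer_inj.
case: pickP => [t /andP[tx xt]|/(_ y)] /=.
  by split=> // u ux xu; rewrite (U' u) // (U' t).
by rewrite yx /= => /negP[].
Qed.

Lemma diag_mul_matching : matching (diag_mul C D).
Proof.
apply/matchingP; split=> x; last by case: (diag_mul_mateP x).
have [N1 C1 U1] := diag_mul_mateP x.
have [N2 C2 U2] := diag_mul_mateP (mate (diag_mul C D) x).
by rewrite -(U2 x) // 1?eq_sym // conn_sym.
Qed.

Lemma bigmin_le (I : finType) (P : pred I) (F : I -> nat) m j :
  P j -> \big[minn/m]_(i | P i) F i <= F j.
Proof.
move=> Pj; elim: (index_enum I) (mem_index_enum j) => [|i r IH] //.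
rewrite inE big_cons => /orP[/eqP <-|/IH le]; first by rewrite Pj geq_minl.
by case: ifP => // _; rewrite geq_min le orbT.
Qed.

Lemma diag_mul_lab_le x z : conn (outer x) z ->
  lab (diag_mul C D) x <= stack_lab C D z.
Proof. by rewrite /lab /= ffunE => xz; apply: bigmin_le. Qed.

Lemma diag_mul_lab_ex x :
  exists2 z, conn (outer x) z & lab (diag_mul C D) x = stack_lab C D z.
Proof.
rewrite /lab /= ffunE.
apply: (big_ind (fun m => exists2 z, conn (outer x) z & m = stack_lab C D z)).
- by exists (outer x) => //; exact: connect0.
- move=> m p [z xz ->] [t xt ->]; rewrite /minn; case: ifP => _.
    by exists z.
  by exists t.
- by move=> z xz; exists z.
Qed.
End StackTheory.

Lemma pos_inj N : injective (@pos N).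
Proof.
move=> [s i] [t j]; rewrite /pos /=; have := ltn_ord i; have := ltn_ord j.
case: s; case: t => iN jN E; try (by lia);
  by congr (_, _); apply: val_inj => /=; lia.
Qed.

Lemma pos_neq N (x y : node N) : x != y -> (pos x < pos y) || (pos y < pos x).
Proof. by move=> xy; rewrite -neq_ltn; apply: contraNneq xy => /pos_inj ->. Qed.

Lemma oddposE N (x : node N) : \big[addb/false]_(u : node N) (pos u < pos x) = odd (pos x).
Proof.
have ltE n i : \big[addb/false]_(j < n) (j < i) = odd (minn n i).
  elim: n => [|n IH]; first by rewrite big_ord0 min0n.
  rewrite big_ord_recr /= IH; case: (ltnP n i) => ni.
    by rewrite (minn_idPl ni) /= addbT.
  by rewrite (minn_idPr (leqW ni)) addbF.
have -> : \big[addb/false]_(u : node N) (pos u < pos x) =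
  \big[addb/false]_(j < N) (j < pos x) (+)
  \big[addb/false]_(j < N) (N.*2 - j.+1 < pos x).
  rewrite -(pair_bigA _ (fun s j => pos ((s, j) : node N) < pos x)) /=.
  by rewrite big_bool /= addbC.
have rE : \big[addb/false]_(j < N) (N.*2 - j.+1 < pos x) =
          \big[addb/false]_(j < N) (j < pos x - N).
  rewrite (reindex_inj rev_ord_inj) /=; apply: eq_bigr => j _.
  by have := ltn_ord j; lia.
rewrite rE !ltE; clear; case: x => [[] i]; rewrite /pos /=; have := ltn_ord i; lia.
Qed.

Section Parity.
Variables (N : nat) (C : prediag N).
Hypotheses (mC : matching C) (ncC : noncrossing C).
Local Notation m := (mate C).

Let mK : involutive m. Proof. by case/matchingP: mC. Qed.
Let mN x : m x != x. Proof. by case/matchingP: mC => _; exact. Qed.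

Lemma noncrossingW x y :
  pos x < pos y -> pos y < pos (m x) -> pos (m y) <= pos (m x).
Proof.
move=> xy ymx; have /forallP/(_ x)/forallP/(_ y) := ncC.
by rewrite xy ymx /= -leqNgt.
Qed.

Lemma noncrossingW2 x y :
  pos x < pos y -> pos y < pos (m x) -> pos x <= pos (m y).
Proof.
move=> xy ymx; rewrite leqNgt; apply/negP => myx.
have := @noncrossingW (m y) x myx; rewrite !mK => /(_ xy).
by rewrite leqNgt ymx.
Qed.

Variable S : pred (node N).
Hypothesis Sm : forall x, S x -> S (m x).

Lemma SmE x : S (m x) = S x.
Proof. by apply/idP/idP => /Sm; rewrite ?mK. Qed.

Lemma big_pairs (F : node N -> bool) :
  \big[addb/false]_(u | S u) F u =
  \big[addb/false]_(u | S u && (pos u < pos (m u))) (F u (+) F (m u)).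
Proof.
rewrite (bigID (fun u => pos u < pos (m u))) /= big_split /=; congr (_ (+) _).
rewrite (reindex_inj (inv_inj mK)) /=; apply: eq_bigl => u; rewrite SmE mK.
congr (_ && _); have := pos_neq (mN u).
by case: ltngtP.
Qed.

(* Parity of the number of nodes of S before x. *)
Definition ph (x : node N) : bool :=
  \big[addb/false]_(u | S u) (pos u < pos x).

Lemma ph_total : \big[addb/false]_(u | S u) true = false.
Proof. by rewrite big_pairs big1. Qed.

(* Noncrossing enters here: an arc outside S encloses an even number of nodes
   of S. *)
Lemma ph_mate x : ph (m x) = ph x (+) S x.
Proof.
apply/eqP; rewrite -(can2_eq (addKb _) (addKb _)) -/(ph x).
rewrite /ph -big_split /= big_pairs; apply/eqP.
have sepF u : pos u < pos (m u) -> u != x -> u != m x ->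
  ((pos u < pos x) (+) (pos u < pos (m x)))
  (+) ((pos (m u) < pos x) (+) (pos (m u) < pos (m x))) = false.
  move=> umu ux umx.
  have mux : m u != x by apply: contraNneq umx => <-; rewrite mK.
  have mumx : m u != m x by rewrite (inj_eq (inv_inj mK)).
  have := pos_neq ux; have := pos_neq umx.
  have := pos_neq mux; have := pos_neq mumx.
  have := @noncrossingW u x; have := @noncrossingW2 u x.
  have := @noncrossingW u (m x); have := @noncrossingW2 u (m x).
  rewrite !mK; lia.
case: (boolP (S x)) => [Sx|Sx]; last first.
  rewrite big1 // => u /andP[Su umu]; apply: sepF => //.
    by apply: contraNneq Sx => <-.
  by apply: contraNneq Sx => E; rewrite -SmE -E.
pose y := if pos x < pos (m x) then x else m x.
have yx : (y == x) || (y == m x) by rewrite /y; case: ifP; rewrite eqxx ?orbT.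
have Sy : S y by case/orP: yx => /eqP->; rewrite ?SmE.
have ymy : pos y < pos (m y).
  rewrite /y; case: ifP => // xmx; rewrite mK.
  by have := pos_neq (mN x); rewrite xmx orbF.
have {}yx : x = y \/ x = m y.
  by case/orP: yx => /eqP->; [left | right]; rewrite ?mK.
rewrite (bigD1 y) /=; last by rewrite Sy.
rewrite big1 ?addbF => [|u /andP[/andP[Su umu] uy]].
  by case: yx => ->; rewrite ?mK !ltnn ymy ltnNge (ltnW ymy).
apply: sepF => //; case: yx => ->; rewrite ?mK //.
  by apply: contraTneq umu => ->; rewrite mK -leqNgt ltnW.
by apply: contraTneq umu => ->; rewrite mK -leqNgt ltnW.
Qed.

Lemma ph_nested y : ph y -> (S y -> pos y < pos (m y)) ->
  exists2 u, S u & nested C y u || nested C (m y) u.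
Proof.
move=> py Sy; case: (pickP (fun u => S u && (pos u < pos y < pos (m u)))).
  move=> u /and3P[Su uy ymu]; exists u => //.
  have ux : m y != u by apply: contraTneq ymu => <-; rewrite mK ltnn.
  have mymu : m y != m u.
    by rewrite (inj_eq (inv_inj mK)); apply: contraTneq uy => ->; rewrite ltnn.
  have := pos_neq ux; have := pos_neq mymu; have := pos_neq (mN y).
  have := noncrossingW uy ymu; have := noncrossingW2 uy ymu.
  rewrite /nested !mK; lia.
move=> H; move: py; rewrite /ph big_pairs big1 // => u /andP[Su umu].
have := H u; rewrite Su /=.
have E : m u = y -> u = m y by move=> <-; rewrite mK.
have [/E uy|muy] := eqVneq (m u) y; last by have := pos_neq muy; lia.
by move: umu Su Sy; rewrite uy SmE mK => ? Sy /(_ Sy); lia.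
Qed.

End Parity.

Lemma odd_pos_mate N (C : prediag N) : matching C -> noncrossing C ->
  forall x, odd (pos (mate C x)) = ~~ odd (pos x).
Proof.
move=> mC ncC x; rewrite -!oddposE.
have := @ph_mate N C mC ncC predT (fun _ _ => isT) x.
by rewrite /ph /= addbT.
Qed.

Lemma odd_minn_absn N (C : prediag N) : matching C -> noncrossing C ->
  forall x, pos x < pos (mate C x) ->
  odd (minn (absn x) (absn (mate C x))) = ~~ odd (pos x).
Proof.
move=> mC ncC x; have := odd_pos_mate mC ncC x.
case: x (mate C x) => [s i] [t j]; rewrite /pos /absn /=.
have := ltn_ord i; have := ltn_ord j.
by case: s; case: t => /=; lia.
Qed.

Section Glued.
Variables (N : nat) (C D : prediag N).
Hypotheses (mC : matching C) (mD : matching D).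
Hypotheses (ncC : noncrossing C) (ncD : noncrossing D).
Variable O : pred (node N + node N).
Hypotheses (Of : forall z, O z -> O (strand C D z)).
Hypotheses (Og : forall z, O z -> O (glue z)).

Let SC : pred (node N) := fun x => O (inl x).
Let SD : pred (node N) := fun x => O (inr x).
Let S' : pred (node N) := fun x => O (outer x).

Let SCm x : SC x -> SC (mate C x). Proof. exact: (Of (z := inl x)). Qed.
Let SDm x : SD x -> SD (mate D x). Proof. exact: (Of (z := inr x)). Qed.

Definition PH (z : node N + node N) : bool :=
  match z with inl x => ph SC x | inr x => ph SD x end.

Lemma OfE z : O (strand C D z) = O z.
Proof. by apply/idP/idP => /Of; rewrite ?(strandK mC mD). Qed.

Lemma OgE z : O (glue z) = O z.
Proof. by apply/idP/idP => /Og; rewrite ?glueK. Qed.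

Lemma PH_strand z : PH (strand C D z) = PH z (+) O z.
Proof. by case: z => x; rewrite /= ph_mate. Qed.

Lemma big_node (P : pred (node N)) (F : node N -> bool) :
  \big[addb/false]_(u | P u) F u =
  \big[addb/false]_(j | P (false, j)) F (false, j) (+)
  \big[addb/false]_(j | P (true, j)) F (true, j).
Proof.
rewrite (eq_bigl (fun u : node N => P (u.1, u.2))); last by case.
rewrite (eq_bigr (fun u : node N => F (u.1, u.2))); last by case.
rewrite -(pair_big_dep predT (fun s j => P (s, j)) (fun s j => F (s, j))) /=.
by rewrite big_bool /= addbC.
Qed.

Lemma midE j : SC (true, j) = SD (false, j).
Proof. exact: esym (OgE (inl (true, j))). Qed.

Lemma totC : \big[addb/false]_(j | SC (false, j)) true =
             \big[addb/false]_(j | SC (true, j)) true.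
Proof.
by apply/eqP; rewrite -[_ == _]negbK negb_eqb -(big_node SC (fun=> true)) (ph_total mC).
Qed.

Lemma totD : \big[addb/false]_(j | SD (true, j)) true =
             \big[addb/false]_(j | SC (true, j)) true.
Proof.
rewrite (eq_bigl _ _ midE); apply/eqP; rewrite eq_sym.
by rewrite -[_ == _]negbK negb_eqb -(big_node SD (fun=> true)) (ph_total mD).
Qed.

Lemma ph_false (P : pred (node N)) i :
  ph P (false, i) = \big[addb/false]_(j | P (false, j)) (j < i).
Proof.
rewrite /ph big_node [X in _ (+) X]big1 ?addbF //= => j _.
by rewrite /pos /=; have := ltn_ord i; have := ltn_ord j; lia.
Qed.

Lemma ph_true (P : pred (node N)) i :
  ph P (true, i) = \big[addb/false]_(j | P (false, j)) true (+)
                   \big[addb/false]_(j | P (true, j)) (i < j).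
Proof.
rewrite /ph big_node; congr (_ (+) _); apply: eq_bigr => j _;
  by rewrite /pos /=; have := ltn_ord i; have := ltn_ord j; lia.
Qed.

Lemma PH_mid i : PH (inr (false, i)) = PH (inl (true, i)) (+) O (inl (true, i)).
Proof.
rewrite /= ph_false ph_true totC -(eq_bigl _ _ midE) -big_split /=.
apply/eqP; rewrite -(can2_eq (addKb _) (addKb _)) -big_split /=; apply/eqP.
rewrite -[O _]/(SC (true, i)) (eq_bigr (fun j => j == i)) => [|j _]; last first.
  by rewrite -(inj_eq val_inj) /=; case: ltngtP.
case: (boolP (SC (true, i))) => Si.
  by rewrite (bigD1 i) //= eqxx big1 // => j /andP[_ /negPf].
by rewrite big1 // => j; apply: contraTF => /eqP->.
Qed.

Lemma PH_glue z : PH (glue z) = PH z (+) (O z && (glue z != z)).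
Proof.
case: z => [[[] i]|[[] i]]; rewrite ?eqxx ?andbF ?addbF // [glue _]/=.
  by rewrite PH_mid andbT.
by rewrite PH_mid andbT -(OgE (inr (false, i))) addbK.
Qed.

Lemma PH_outer x : PH (outer x) = ph S' x.
Proof.
case: x => [[] i]; rewrite /outer /=; last by rewrite !ph_false.
by rewrite !ph_true -(eq_bigl _ _ midE) -totC.
Qed.

Lemma PH_const z t : connect (stacked C D) z t -> ~~ O z -> PH t = PH z.
Proof.
move=> zt Oz; suff [] : PH t = PH z /\ ~~ O t by [].
move: t zt; apply: connect_ind => // t u [Pt Ot] /orP[] /eqP ->.
  by rewrite PH_strand OfE (negPf Ot) addbF.
by rewrite PH_glue OgE (negPf Ot) addbF.
Qed.

Definition zpos (z : node N + node N) : nat :=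
  match z with inl x => pos x | inr x => pos x end.

Lemma PH_zpos z t : connect (stacked C D) z t -> O z ->
  PH t (+) odd (zpos t) = PH z (+) odd (zpos z).
Proof.
move=> zt Oz; suff [] : PH t (+) odd (zpos t) = PH z (+) odd (zpos z) /\ O t by [].
move: t zt; apply: connect_ind => // t u [Pt Ot] /orP[] /eqP ->.
  rewrite PH_strand OfE Ot; split=> //; rewrite -Pt.
  have -> : odd (zpos (strand C D t)) = ~~ odd (zpos t).
    by case: t {Pt Ot} => x /=; rewrite odd_pos_mate.
  by rewrite addbT addNb addbN negbK.
rewrite PH_glue OgE Ot; split=> //; rewrite -Pt.
case: eqVneq => [->|gt] /=; first by rewrite addbF.
have -> : odd (zpos (glue t)) = ~~ odd (zpos t).
  case: t {Pt Ot} gt => [[[] i]|[[] i]]; rewrite ?eqxx //= => _;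
    rewrite /pos /=; have := ltn_ord i; lia.
by rewrite addbT addNb addbN negbK.
Qed.
End Glued.

Lemma ph_pair N (a b x : node N) (P : pred (node N)) : a != b ->
  (forall u, P u = (u == a) || (u == b)) ->
  ph P x = (pos a < pos x) (+) (pos b < pos x).
Proof.
move=> ab PE; rewrite /ph (eq_bigl _ _ PE) (bigD1 a) ?eqxx //=.
rewrite (bigD1 b) /=; last by rewrite eqxx orbT eq_sym ab.
by rewrite big1 ?addbF // => u; case: eqP => //=; case: eqP.
Qed.

Lemma okadaP N (C : prediag N) : reflect
  [/\ matching C, noncrossing C,
      forall x, [/\ lab C (mate C x) = lab C x, 0 < lab C x,
        lab C x <= minn (absn x) (absn (mate C x))
        & odd (lab C x) = odd (minn (absn x) (absn (mate C x)))]
      & forall x y, nested C x y -> lab C y < lab C x] (okada_arc C).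
Proof.
apply: (iffP and3P) => [[mC ncC /andP[/forallP L /forallP H]]|[mC ncC L H]].
  split=> // [x|x y].
    by have /and3P[/eqP ? /andP[? ?] /eqP] := L x.
  by move/forallP/(_ y)/implyP: (H x).
split=> //; apply/andP; split; apply/forallP => x.
  by have [H1 H2 H3 H4] := L x; rewrite /= H1 H2 H3 H4 !eqxx.
by apply/forallP => y; apply/implyP/H.
Qed.

Section DiagMulOkada.
Variables (N : nat) (C D : prediag N).
Hypotheses (oC : okada_arc C) (oD : okada_arc D).

Let mC : matching C. Proof. by case/okadaP: oC. Qed.
Let mD : matching D. Proof. by case/okadaP: oD. Qed.
Let ncC : noncrossing C. Proof. by case/okadaP: oC. Qed.
Let ncD : noncrossing D. Proof. by case/okadaP: oD. Qed.

Let conn := connect (stacked C D).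
Local Notation M := (mate (diag_mul C D)).
Let Ox x : pred (node N + node N) := conn (outer x).

Let Of x z : Ox x z -> Ox x (strand C D z). Proof. exact: conn_strand. Qed.
Let Og x z : Ox x z -> Ox x (glue z). Proof. exact: conn_glue. Qed.

Lemma Ox_outer x u : Ox x (outer u) = (u == x) || (u == M x).
Proof.
have [_ xM U] := diag_mul_mateP mC mD x.
apply/idP/idP => [xu|/orP[]/eqP-> //]; last exact: connect0.
by have [//|ux] := eqVneq u x; rewrite (U u) ?eqxx.
Qed.

Lemma PH_outer2 x y :
  PH (Ox x) (outer y) = (pos x < pos y) (+) (pos (M x) < pos y).
Proof.
rewrite (PH_outer mC mD ncC ncD (@Of x) (@Og x)).
apply: ph_pair => [|u]; last exact: Ox_outer.
by rewrite eq_sym; case: (diag_mul_mateP mC mD x).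
Qed.

Lemma PH_other x y : ~~ Ox x (outer y) ->
  PH (Ox x) (outer (M y)) = PH (Ox x) (outer y).
Proof.
move=> xy; apply: (PH_const mC mD ncC ncD (@Of x) (@Og x)) xy.
by case: (diag_mul_mateP mC mD y).
Qed.

Lemma diag_mul_noncrossing : noncrossing (diag_mul C D).
Proof.
apply/forallP => x; apply/forallP => y; apply/negP => /and3P[xy yMx MxMy].
have xNy : ~~ Ox x (outer y).
  rewrite Ox_outer; apply/norP; split.
    by apply: contraTneq xy => ->; rewrite ltnn.
  by apply: contraTneq yMx => ->; rewrite ltnn.
have := PH_other xNy; rewrite !PH_outer2; lia.
Qed.

Lemma zlab_nested (P : pred (node N + node N)) z :
    (forall z, P z -> P (strand C D z)) ->
    PH P z -> (P z -> zpos z < zpos (strand C D z)) ->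
  exists2 t, P t & stack_lab C D t < stack_lab C D z.
Proof.
move=> Pf; case: z => x /= Px xmx.
  have [u Su nu] := ph_nested (C := C) mC ncC (S := fun x => P (inl x))
    (fun x => Pf (inl x)) Px xmx.
  exists (inl u) => //=; case/okadaP: oC => _ _ L H.
  by case/orP: nu => /H //; case: (L x) => ->.
have [u Su nu] := ph_nested (C := D) mD ncD (S := fun x => P (inr x))
  (fun x => Pf (inr x)) Px xmx.
exists (inr u) => //=; case/okadaP: oD => _ _ L H.
by case/orP: nu => /H //; case: (L x) => ->.
Qed.

Lemma stack_lab_strand z : stack_lab C D (strand C D z) = stack_lab C D z.
Proof.
case/okadaP: oC => _ _ LC _; case/okadaP: oD => _ _ LD _.
by case: z => x /=; [case: (LC x) | case: (LD x)].
Qed.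

Lemma diag_mul_lab_nested x y :
  nested (diag_mul C D) x y -> lab (diag_mul C D) y < lab (diag_mul C D) x.
Proof.
case/and3P=> yx xMx MxMy.
have [z xz ->] := diag_mul_lab_ex C D x.
have yNx : ~~ Ox y (outer x).
  rewrite Ox_outer; apply/norP; split.
    by apply: contraTneq yx => ->; rewrite ltnn.
  by apply: contraTneq (ltn_trans xMx MxMy) => ->; rewrite ltnn.
have yNz : ~~ Ox y z.
  apply: contra yNx => yz; apply: connect_trans yz _.
  by rewrite conn_sym.
have Pz : PH (Ox y) z.
  rewrite (PH_const mC mD ncC ncD (@Of y) (@Og y) xz) // PH_outer2; lia.
have [t yt] := zlab_nested (@Of y) Pz (fun H => False_ind _ (negP yNz H)).
by apply: leq_ltn_trans; exact: diag_mul_lab_le.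
Qed.

Lemma diag_mul_lab_mate x : lab (diag_mul C D) (M x) = lab (diag_mul C D) x.
Proof.
suff le y : lab (diag_mul C D) (M y) <= lab (diag_mul C D) y.
  apply/eqP; rewrite eqn_leq le /=.
  have /matchingP[MK _] := diag_mul_matching mC mD.
  by rewrite -{1}(MK x) le.
have [z yz ->] := diag_mul_lab_ex C D y.
apply: diag_mul_lab_le; apply: connect_trans yz.
by rewrite conn_sym //; case: (diag_mul_mateP mC mD y).
Qed.

Lemma diag_mul_lab_absn x : lab (diag_mul C D) x <= absn x.
Proof.
apply: (leq_trans (diag_mul_lab_le (connect0 (stacked C D) (outer x)))).
case/okadaP: oC => _ _ LC _; case/okadaP: oD => _ _ LD _.
case: x => [[] i]; rewrite /outer /=.
  by case: (LD (true, i)) => _ _; rewrite leq_min => /andP[].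
by case: (LC (false, i)) => _ _; rewrite leq_min => /andP[].
Qed.

Lemma diag_mul_lab_odd x : pos x < pos (M x) ->
  odd (lab (diag_mul C D) x) = odd (minn (absn x) (absn (M x))).
Proof.
move=> xMx.
rewrite odd_minn_absn //; [|exact: diag_mul_matching|exact: diag_mul_noncrossing].
suff [z [xz zfz labz]] : exists z, [/\ Ox x z, zpos z < zpos (strand C D z)
    & lab (diag_mul C D) x = stack_lab C D z].
  have Pz : PH (Ox x) z = false.
    apply/negP => Pz.
    have [t xt] := zlab_nested (@Of x) Pz (fun _ => zfz).
    by rewrite ltnNge -labz diag_mul_lab_le.
  have := PH_zpos mC mD ncC ncD (@Of x) (@Og x) xz (connect0 _ _).
  rewrite Pz PH_outer2 ltnn ltnNge (ltnW xMx) /= => E.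
  have -> : odd (pos x) = odd (zpos z).
    by rewrite E; case: (x) => [[] i].
  rewrite labz; case: z zfz {xz labz Pz E} => y /= ymy.
    case/okadaP: oC => _ _ /(_ y)[_ _ _ ->] _; exact: odd_minn_absn.
  case/okadaP: oD => _ _ /(_ y)[_ _ _ ->] _; exact: odd_minn_absn.
have [z xz labz] := diag_mul_lab_ex C D x.
have [zfz|] := boolP (zpos z < zpos (strand C D z)); first by exists z.
move=> zfz; exists (strand C D z); split; first exact: Of.
  rewrite strandK //; have : zpos z != zpos (strand C D z).
    case: z {xz labz zfz} => y /=; rewrite (inj_eq (@pos_inj N)) eq_sym.
      by case/matchingP: mC => _.
    by case/matchingP: mD => _.
  by lia.
by rewrite stack_lab_strand.
Qed.

Lemma diag_mul_okada : okada_arc (diag_mul C D).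
Proof.
have mCD := diag_mul_matching mC mD; have /matchingP[MK MN] := mCD.
apply/okadaP; split=> // [|x|x y]; last 1 first.
- exact: diag_mul_lab_nested.
- exact: diag_mul_noncrossing.
split; first exact: diag_mul_lab_mate.
- have [z _ ->] := diag_mul_lab_ex C D x.
  case/okadaP: oC => _ _ LC _; case/okadaP: oD => _ _ LD _.
  by case: z => y /=; [case: (LC y) | case: (LD y)].
- by rewrite leq_min diag_mul_lab_absn -diag_mul_lab_mate diag_mul_lab_absn.
have /orP[xMx|Mxx] := pos_neq (MN x); last exact: diag_mul_lab_odd.
rewrite minnC -diag_mul_lab_mate diag_mul_lab_odd ?MK //.
Qed.
End DiagMulOkada.

Lemma prediag_eq N (C D : prediag N) :
  mate C =1 mate D -> lab C =1 lab D -> C = D.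
Proof.
by case: C D => [c c'] [d d'] H H'; congr (_, _); apply/ffunP.
Qed.

Section Coarse.
Variables (T T' : finType) (e : rel T) (e' : rel T') (l : T -> nat).
Variables (l' : T' -> nat) (phi : T' -> T) (B : T -> T' -> bool).
Hypotheses (He : forall z t, e' z t -> connect e (phi z) (phi t)).
Hypotheses (Hl : forall z, exists2 w, connect e (phi z) w & l' z = l w).
Hypotheses (B0 : forall z, B (phi z) z).
Hypotheses (Bl : forall w z, B w z -> l' z <= l w).
Hypotheses (Bs : forall w z w', B w z -> e w w' ->
  exists2 z', B w' z' & connect e' z z').

Lemma coarse_connect z t : connect e' z t -> connect e (phi z) (phi t).
Proof.
move: t; apply: connect_ind; first exact: connect0.
by move=> t u zt /He; apply: connect_trans.
Qed.

Lemma coarse_lab z w : connect e (phi z) w ->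
  exists2 t, connect e' z t & l' t <= l w.
Proof.
move=> zw; suff [t Bt zt] : exists2 t, B w t & connect e' z t.
  by exists t => //; exact: Bl.
move: w zw; apply: connect_ind; first by exists z.
move=> w w' [t Bt zt] /(Bs Bt)[t' Bt' tt']; exists t' => //.
exact: connect_trans tt'.
Qed.
End Coarse.

Section Triple.
Variables (N : nat) (C D E : prediag N).
Hypotheses (mC : matching C) (mD : matching D) (mE : matching E).
Let T := ((node N + node N) + node N)%type.

Definition strand3 (z : T) : T :=
  match z with inl z => inl (strand C D z) | inr x => inr (mate E x) end.

Definition glue3 (z : T) : T :=
  match z with
  | inl (inl (true, i)) => inl (inr (false, i))
  | inl (inr (false, i)) => inl (inl (true, i))
  | inl (inr (true, i)) => inr (false, i)
  | inr (false, i) => inl (inr (true, i))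
  | _ => z
  end.

Definition outer3 (x : node N) : T := if x.1 then inr x else inl (inl x).

Definition lab3 (z : T) : nat :=
  match z with inl z => stack_lab C D z | inr x => lab E x end.

Let e3 := zedge strand3 glue3.
Let conn3 := connect e3.

Lemma strand3K : involutive strand3.
Proof.
case/matchingP: mE => EK _.
by case=> z /=; rewrite ?(strandK mC mD) ?EK.
Qed.

Lemma strand3N z : strand3 z != z.
Proof.
case/matchingP: mE => _ EN.
case: z => z /=; apply/eqP => -[] H; first by have /eqP := strandN mC mD z.
by have /eqP := EN z.
Qed.

Lemma glue3K : involutive glue3.
Proof. by move=> [[[[] i]|[[] i]]|[[] i]]. Qed.

Lemma glue3_outer x : glue3 (outer3 x) = outer3 x.
Proof. by case: x => [[] i]. Qed.

Lemma outer3_inj : injective outer3.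
Proof. by move=> [[] i] [[] j] // [->]. Qed.

(* X is the diagram read off the threefold stack of C, D and E. *)
Definition contracts3 (X : prediag N) := forall x,
  [/\ mate X x != x, conn3 (outer3 x) (outer3 (mate X x)),
      exists2 z, conn3 (outer3 x) z & lab X x = lab3 z
    & forall z, conn3 (outer3 x) z -> lab X x <= lab3 z].

Lemma contracts3_uniq X Y : contracts3 X -> contracts3 Y -> X = Y.
Proof.
move=> HX HY; apply: prediag_eq => x.
  have [NX CX _ _] := HX x; have [NY CY _ _] := HY x.
  have [y [_ _ _ U]] := zigzag strand3K glue3K strand3N (glue3_outer x).
  apply: outer3_inj; have [E1|->] := U _ CX (glue3_outer _).
    by rewrite (outer3_inj E1) eqxx in NX.
  have [E1|->//] := U _ CY (glue3_outer _).
  by rewrite (outer3_inj E1) eqxx in NY.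
have [_ _ [z xz EX] LX] := HX x; have [_ _ [t xt EY] LY] := HY x.
by apply/eqP; rewrite eqn_leq {1}EY LX //= EX LY.
Qed.

Lemma conn3_strand x y : conn3 x y -> conn3 x (strand3 y).
Proof. exact: zconnect_f. Qed.

Lemma conn3_glue x y : conn3 x y -> conn3 x (glue3 y).
Proof. exact: zconnect_g. Qed.

Lemma conn3_refl x : conn3 x x. Proof. exact: connect0. Qed.

Lemma lift_left z t : connect (stacked C D) z t -> conn3 (inl z) (inl t).
Proof.
move: t; apply: connect_ind => [|t u zt /orP[]/eqP->]; first exact: conn3_refl.
  exact: (conn3_strand zt).
have := conn3_glue zt; case: t zt => [[[] i]|[[] i]] //=.
Qed.

Definition rinj (z : node N + node N) : T :=
  match z with inl x => inl (inr x) | inr x => inr x end.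

Lemma lift_right z t : connect (stacked D E) z t -> conn3 (rinj z) (rinj t).
Proof.
move: t; apply: connect_ind => [|t u zt /orP[]/eqP->]; first exact: conn3_refl.
  by have := conn3_strand zt; case: t zt.
have := conn3_glue zt; case: t zt => [[[] i]|[[] i]] //=.
Qed.

Lemma step_strand A B z t : connect (@stacked N A B) z t ->
  connect (stacked A B) z (strand A B t).
Proof. exact: zconnect_f. Qed.

Lemma step_glue A B z t : connect (@stacked N A B) z t ->
  connect (stacked A B) z (glue t).
Proof. exact: zconnect_g. Qed.

Lemma conn_outer A B x y : matching A -> matching B ->
    connect (@stacked N A B) (outer x) (outer y) ->
  y = x \/ y = mate (diag_mul A B) x.
Proof.
move=> mA mB xy; have [_ _ U] := diag_mul_mateP mA mB x.
by have [->|yx] := eqVneq y x; [left | right; apply: U].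
Qed.

Lemma contracts3_left : contracts3 (diag_mul (diag_mul C D) E).
Proof.
have mCD := diag_mul_matching mC mD.
pose phi (z : node N + node N) : T :=
  match z with inl u => inl (outer u) | inr u => inr u end.
pose B (w : T) (z : node N + node N) := match w, z with
  | inl w, inl u => connect (stacked C D) (outer u) w
  | inr y, inr u => y == u
  | _, _ => false end.
have He z t : stacked (diag_mul C D) E z t -> conn3 (phi z) (phi t).
  case/orP=> /eqP->.
    case: z => x /=; last exact: conn3_strand (conn3_refl _).
    by apply: lift_left; case: (diag_mul_mateP mC mD x).
  have := conn3_glue (conn3_refl (phi z)).
  by case: z => [[[] i]|[[] i]] //= _; exact: conn3_refl.
have Hl z : exists2 w, conn3 (phi z) w & stack_lab (diag_mul C D) E z = lab3 w.
  case: z => x /=; last by exists (inr x) => //; exact: conn3_refl.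
  by have [w xw ->] := diag_mul_lab_ex C D x; exists (inl w) => //; exact: lift_left.
have B0 z : B (phi z) z by case: z => x /=; [exact: connect0 | rewrite eqxx].
have Bl w z : B w z -> stack_lab (diag_mul C D) E z <= lab3 w.
  by case: w z => w [z|z] //=; [exact: diag_mul_lab_le | move/eqP->].
have Bs w z w' : B w z -> e3 w w' ->
    exists2 z', B w' z' & connect (stacked (diag_mul C D) E) z z'.
  move=> Bw; case/orP=> /eqP->{w'}.
    case: w z Bw => w [u|u] //= Bw.
      by exists (inl u); [exact: step_strand | exact: connect0].
    exists (inr (mate E u)); first by rewrite (eqP Bw).
    exact: step_strand (connect0 _ (inr u)).
  case: w z Bw => [[[[] i]|[[] i]]|[[] i]] [u|u] //= Bw.
  - by exists (inl u); [exact: (step_glue Bw) | exact: connect0].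
  - by exists (inl u); [exact: Bw | exact: connect0].
  - exists (inr (false, i)); first exact: eqxx.
    have Bi : connect (stacked C D) (outer u) (outer (true, i)) by [].
    have [<-|Eu] := conn_outer mC mD Bi.
      exact: (step_glue (connect0 _ (inl (true, i)))).
    by have := step_glue (step_strand (connect0 (stacked (diag_mul C D) E) (inl u)));
      rewrite /= -Eu.
  - by exists (inl u); [exact: (step_glue Bw) | exact: connect0].
  - exists (inr (true, i)) => //; rewrite (eqP Bw); exact: connect0.
  - exists (inl (true, i)); first exact: connect0.
    by rewrite -(eqP Bw); exact: (step_glue (connect0 _ (inr (false, i)))).
move=> x.
have phio y : phi (outer y) = outer3 y by case: y => [[] i].
have [NX CX _] := diag_mul_mateP mCD mE x.
have CC := coarse_connect He; have CL := coarse_lab B0 Bl Bs.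
split=> //.
- by rewrite -!phio; exact: CC.
- have [z xz ->] := diag_mul_lab_ex (diag_mul C D) E x; have [w zw ->] := Hl z.
  by exists w => //; rewrite -phio; exact: connect_trans (CC _ _ xz) zw.
move=> z; rewrite -phio => /CL[t xt]; apply: leq_trans.
exact: diag_mul_lab_le.
Qed.

Lemma contracts3_right : contracts3 (diag_mul C (diag_mul D E)).
Proof.
have mDE := diag_mul_matching mD mE.
pose phi (z : node N + node N) : T :=
  match z with inl u => inl (inl u) | inr u => rinj (outer u) end.
pose B (w : T) (z : node N + node N) := match w, z with
  | inl (inl y), inl u => y == u
  | inl (inr y), inr u => connect (stacked D E) (outer u) (inl y)
  | inr y, inr u => connect (stacked D E) (outer u) (inr y)
  | _, _ => false end.
have He z t : stacked C (diag_mul D E) z t -> conn3 (phi z) (phi t).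
  case/orP=> /eqP->.
    case: z => x /=; first exact: conn3_strand (conn3_refl _).
    by apply: lift_right; case: (diag_mul_mateP mD mE x).
  have := conn3_glue (conn3_refl (phi z)).
  by case: z => [[[] i]|[[] i]] //= _; exact: conn3_refl.
have Hl z : exists2 w, conn3 (phi z) w & stack_lab C (diag_mul D E) z = lab3 w.
  case: z => x /=; first by exists (inl (inl x)) => //; exact: conn3_refl.
  have [w xw ->] := diag_mul_lab_ex D E x; exists (rinj w); first exact: lift_right.
  by case: w {xw}.
have B0 z : B (phi z) z.
  by case: z => [x|[[] i]] /=; [rewrite eqxx | exact: connect0..].
have Bl w z : B w z -> stack_lab C (diag_mul D E) z <= lab3 w.
  by case: w z => [[w|w]|w] [z|z] //=; [move/eqP-> | exact: diag_mul_lab_le..].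
have Bs w z w' : B w z -> e3 w w' ->
    exists2 z', B w' z' & connect (stacked C (diag_mul D E)) z z'.
  move=> Bw; case/orP=> /eqP->{w'}.
    case: w z Bw => [[w|w]|w] [u|u] //= Bw.
    - exists (inl (mate C u)); first by rewrite (eqP Bw).
      exact: step_strand (connect0 _ (inl u)).
    - by exists (inr u); [exact: (step_strand Bw) | exact: connect0].
    - by exists (inr u); [exact: (step_strand Bw) | exact: connect0].
  case: w z Bw => [[[[] i]|[[] i]]|[[] i]] [u|u] //= Bw.
  - exists (inr (false, i)); first exact: connect0.
    by rewrite -(eqP Bw); exact: (step_glue (connect0 _ (inl (true, i)))).
  - exists (inl (false, i)) => //; rewrite (eqP Bw); exact: connect0.
  - by exists (inr u); [exact: (step_glue Bw) | exact: connect0].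
  - exists (inl (true, i)); first exact: eqxx.
    have Bi : connect (stacked D E) (outer u) (outer (false, i)) by [].
    have [<-|Eu] := conn_outer mD mE Bi.
      exact: (step_glue (connect0 _ (inr (false, i)))).
    by have := step_glue (step_strand (connect0 (stacked C (diag_mul D E)) (inr u)));
      rewrite /= -Eu.
  - by exists (inr u); [exact: Bw | exact: connect0].
  - by exists (inr u); [exact: (step_glue Bw) | exact: connect0].
move=> x.
have phio y : phi (outer y) = outer3 y by case: y => [[] i].
have [NX CX _] := diag_mul_mateP mC mDE x.
have CC := coarse_connect He; have CL := coarse_lab B0 Bl Bs.
split=> //.
- by rewrite -!phio; exact: CC.
- have [z xz ->] := diag_mul_lab_ex C (diag_mul D E) x; have [w zw ->] := Hl z.
  by exists w => //; rewrite -phio; exact: connect_trans (CC _ _ xz) zw.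
move=> z; rewrite -phio => /CL[t xt]; apply: leq_trans.
exact: diag_mul_lab_le.
Qed.
End Triple.

Lemma diag_mul_assoc N (C D E : prediag N) :
  matching C -> matching D -> matching E ->
  diag_mul C (diag_mul D E) = diag_mul (diag_mul C D) E.
Proof.
move=> mC mD mE; apply: (contracts3_uniq mC mD mE).
  exact: contracts3_right.
exact: contracts3_left.
Qed.

Definition id_diag N : prediag N :=
  ([ffun x => (~~ x.1, x.2)], [ffun x => absn x]).

Lemma id_okada N : okada_arc (id_diag N).
Proof.
have mE x : mate (id_diag N) x = (~~ x.1, x.2) by rewrite /mate /= ffunE.
have lE x : lab (id_diag N) x = absn x by rewrite /lab /= ffunE.
apply/okadaP; split.
- apply/matchingP; split=> [[s i]|[s i]]; rewrite !mE /= ?negbK //.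
  by apply/eqP => -[]; case: s.
- apply/forallP => x; apply/forallP => y; rewrite !mE /pos.
  case: x y => [s i] [t j]; have := ltn_ord i; have := ltn_ord j.
  by case: s; case: t => /=; lia.
- by move=> x; rewrite !lE mE /absn /= minnn.
move=> x y; rewrite !lE /nested !mE /pos /absn.
case: x y => [s i] [t j]; have := ltn_ord i; have := ltn_ord j.
by case: s; case: t => /=; lia.
Qed.

Lemma diag_mul_eq N (A B C : prediag N) (P : node N -> pred (node N + node N)) :
    matching A -> matching B -> (forall x, mate C x != x) ->
    (forall x, connect (stacked A B) (outer x) (outer (mate C x))) ->
    (forall x, exists2 z, connect (stacked A B) (outer x) z &
      stack_lab A B z = lab C x) ->
    (forall x, P x (outer x)) ->
    (forall x z, P x z -> P x (strand A B z) /\ P x (glue z)) ->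
    (forall x z, P x z -> lab C x <= stack_lab A B z) ->
  diag_mul A B = C.
Proof.
move=> mA mB CN CC CL P0 Ps Pl; apply: prediag_eq => x.
  by have [_ _ U] := diag_mul_mateP mA mB x; rewrite -(U (mate C x)).
have [z xz lz] := CL x; apply/eqP; rewrite eqn_leq -{1}lz diag_mul_lab_le //=.
have [t xt ->] := diag_mul_lab_ex A B x; apply: Pl.
move: t xt; apply: connect_ind => // t u /Ps[Pt Pt'].
by case/orP=> /eqP->.
Qed.

Section Unit.
Variables (N : nat) (C : prediag N).
Hypothesis oC : okada_arc C.

Let mC : matching C. Proof. by case/okadaP: oC. Qed.
Let m1 : matching (id_diag N). Proof. by case/okadaP: (id_okada N). Qed.
Let mN x : mate C x != x. Proof. by case/matchingP: mC => _; exact. Qed.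
Let mK : involutive (mate C). Proof. by case/matchingP: mC. Qed.
Let labm x : lab C (mate C x) = lab C x.
Proof. by case/okadaP: oC => _ _ /(_ x)[]. Qed.
Let lab_le x : lab C x <= absn x.
Proof. by case/okadaP: oC => _ _ /(_ x)[_ _]; rewrite leq_min => /andP[]. Qed.

Lemma diag_mul1 : diag_mul C (id_diag N) = C.
Proof.
pose P x (z : node N + node N) := match z with
  | inl y => (y == x) || (y == mate C x)
  | inr y => ((true, y.2) == x) || ((true, y.2) == mate C x) end.
have L x : connect (stacked C (id_diag N)) (outer x) (inl x).
  case: x => [[] i]; last exact: connect0.
  have := step_glue (step_strand (connect0 (stacked C (id_diag N))
    (inr (true, i)))).
  by rewrite /= /mate /= ffunE.
have Lm x : connect (stacked C (id_diag N)) (outer x) (inl (mate C x)).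
  exact: step_strand (L x).
apply: (@diag_mul_eq N _ _ _ P) => //.
- move=> x; apply: connect_trans (Lm x) _.
  by rewrite conn_sym.
- by move=> x; exists (inl x).
- by move=> [[] i]; rewrite /P /= eqxx.
- move=> x [y|y] /= Pz; split.
  + by case/orP: Pz => /eqP->; rewrite ?mK eqxx ?orbT.
  + by case: y Pz => [[] i].
  + by rewrite /mate /= ffunE.
  + by case: y Pz => [[] i].
move=> x [y|y] /=; first by case/orP=> /eqP->; rewrite ?labm.
rewrite [lab (id_diag N) y]ffunE => /orP[/eqP<-|/eqP E].
  exact: (lab_le (true, y.2)).
by rewrite -labm -E (lab_le (true, y.2)).
Qed.

Lemma diag_1mul : diag_mul (id_diag N) C = C.
Proof.
pose P x (z : node N + node N) := match z with
  | inr y => (y == x) || (y == mate C x)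
  | inl y => ((false, y.2) == x) || ((false, y.2) == mate C x) end.
have L x : connect (stacked (id_diag N) C) (outer x) (inr x).
  case: x => [[] i]; first exact: connect0.
  have := step_glue (step_strand (connect0 (stacked (id_diag N) C)
    (inl (false, i)))).
  by rewrite /= /mate /= ffunE.
have Lm x : connect (stacked (id_diag N) C) (outer x) (inr (mate C x)).
  exact: step_strand (L x).
apply: (@diag_mul_eq N _ _ _ P) => //.
- move=> x; apply: connect_trans (Lm x) _.
  by rewrite conn_sym.
- by move=> x; exists (inr x).
- by move=> [[] i]; rewrite /P /= eqxx.
- move=> x [y|y] /= Pz; split.
  + by rewrite /mate /= ffunE.
  + by case: y Pz => [[] i].
  + by case/orP: Pz => /eqP->; rewrite ?mK eqxx ?orbT.
  + by case: y Pz => [[] i].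
move=> x [y|y] /=; last by case/orP=> /eqP->; rewrite ?labm.
rewrite [lab (id_diag N) y]ffunE => /orP[/eqP<-|/eqP E].
  exact: (lab_le (false, y.2)).
by rewrite -labm -E (lab_le (false, y.2)).
Qed.
End Unit.

Record arc_monoid N := Arc { arc_val :> prediag N; arc_valP : okada_arc arc_val }.

HB.instance Definition _ N := [isSub for @arc_val N].
HB.instance Definition _ N := [Choice of arc_monoid N by <:].

Definition arc_mul N (C D : arc_monoid N) : arc_monoid N :=
  Arc (diag_mul_okada (arc_valP C) (arc_valP D)).
Definition arc_one N : arc_monoid N := Arc (id_okada N).

Lemma arc_matching N (C : arc_monoid N) : matching C.
Proof. by case/okadaP: (arc_valP C). Qed.

Lemma arc_mulA N : associative (@arc_mul N).
Proof. by move=> C D E; apply: val_inj; apply: diag_mul_assoc; exact: arc_matching. Qed.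

Lemma arc_1mul N : left_id (@arc_one N) (@arc_mul N).
Proof. by move=> C; apply: val_inj; exact: diag_1mul (arc_valP C). Qed.

Lemma arc_mul1 N : right_id (@arc_one N) (@arc_mul N).
Proof. by move=> C; apply: val_inj; exact: diag_mul1 (arc_valP C). Qed.

HB.instance Definition _ N :=
  isMonoid.Build (arc_monoid N) (@arc_mulA N) (@arc_1mul N) (@arc_mul1 N).

Section Generators.
Variables (N : nat) (i : 'I_N.-1).

(* Generators are also indexed from 0: index i : 'I_N.-1 is A_(i+1), whose two
   short arcs join the 0-based indices i and i+1 and are labelled i+1. *)
Definition ord_lo : 'I_N := widen_ord (leq_pred N) i.

Lemma ord_hi_subproof : i.+1 < N.
Proof. by rewrite -ltn_predRL. Qed.

Definition ord_hi : 'I_N := Ordinal ord_hi_subproof.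

Definition gen_diag : prediag N :=
  ([ffun x : node N =>
      if x.2 == ord_lo then (x.1, ord_hi)
      else if x.2 == ord_hi then (x.1, ord_lo) else (~~ x.1, x.2)],
   [ffun x : node N =>
      if (x.2 == ord_lo) || (x.2 == ord_hi) then i.+1 else absn x]).

Lemma gen_okada : okada_arc gen_diag.
Proof.
have mE s a : mate gen_diag (s, a) = if a == ord_lo then (s, ord_hi) else
    if a == ord_hi then (s, ord_lo) else (~~ s, a) by rewrite /mate /= ffunE.
have lE s a : lab gen_diag (s, a) =
    if (a == ord_lo) || (a == ord_hi) then i.+1 else a.+1.
  by rewrite /lab /= ffunE.
have loE (a : 'I_N) : (a == ord_lo) = (a == i :> nat) by [].
have hiE (a : 'I_N) : (a == ord_hi) = (a == i.+1 :> nat) by [].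
have iN := ord_hi_subproof.
apply/okadaP; split.
- apply/matchingP; split=> [[s a]|[s a]]; rewrite !mE.
    case: eqP => [->|/eqP lo]; last case: eqP => [->|/eqP hi].
    + by rewrite mE hiE loE /= eqxx; case: eqP => //; lia.
    + by rewrite mE eqxx.
    + by rewrite mE (negPf lo) (negPf hi) negbK.
  case: ifP => lo; last case: ifP => hi; apply/eqP => -[].
  + by move=> E; move: lo; rewrite -E loE /=; lia.
  + by move=> E; move: hi; rewrite -E hiE /=; lia.
  + by case: s.
- apply/forallP => -[s a]; apply/forallP => -[t b]; rewrite !mE !loE !hiE /pos.
  have := ltn_ord a; have := ltn_ord b.
  case: (@eqP _ (a : nat) i) => ?; case: (@eqP _ (a : nat) i.+1) => ?;
  case: (@eqP _ (b : nat) i) => ?; case: (@eqP _ (b : nat) i.+1) => ?;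
  by case: s; case: t => /=; lia.
- move=> [s a]; rewrite !mE !lE; have := ltn_ord a; rewrite /absn.
  case: eqP => [->|/eqP lo]; last case: eqP => [->|/eqP hi] /=.
  + by rewrite lE eqxx orbT /=; split=> //; lia.
  + by rewrite lE eqxx /=; split=> //; lia.
  + by rewrite lE (negPf lo) (negPf hi) minnn.
move=> [s a] [t b]; rewrite /nested !mE !lE !loE !hiE /pos.
have := ltn_ord a; have := ltn_ord b.
case: (@eqP _ (a : nat) i) => ?; case: (@eqP _ (a : nat) i.+1) => ?;
  case: (@eqP _ (b : nat) i) => ?; case: (@eqP _ (b : nat) i.+1) => ?;
  by case: s; case: t => /=; lia.
Qed.

Definition arc_gen : arc_monoid N := Arc gen_okada.
End Generators.

Section OkadaCongruence.
Variable N : nat.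
Implicit Types (i j : 'I_N.-1) (u v w : seq 'I_N.-1).

Inductive okada_rule : seq 'I_N.-1 -> seq 'I_N.-1 -> Prop :=
| Okada_idem i : okada_rule [:: i; i] [:: i]
| Okada_comm i j : (i.+1 < j) || (j.+1 < i) ->
    okada_rule [:: i; j] [:: j; i]
| Okada_braid i j : j = i.+1 :> nat -> okada_rule [:: j; i; j] [:: j].

Inductive okada_cong : seq 'I_N.-1 -> seq 'I_N.-1 -> Prop :=
| Okada_rule w w' u v : okada_rule u v ->
    okada_cong (w ++ u ++ w') (w ++ v ++ w')
| Okada_refl u : okada_cong u u
| Okada_sym u v : okada_cong u v -> okada_cong v u
| Okada_trans u v w : okada_cong u v -> okada_cong v w -> okada_cong u w.
End OkadaCongruence.

Lemma okada_cong_ctx N (w1 w2 u v : seq 'I_N.-1) :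
  okada_cong u v -> okada_cong (w1 ++ u ++ w2) (w1 ++ v ++ w2).
Proof.
elim=> {u v} [a b u v uv|u|u v _|u v w _ uv _].
- rewrite !catA -2!(catA (w1 ++ a)) -![(_ ++ b) ++ w2]catA.
  by rewrite -!(catA (w1 ++ a)); exact: Okada_rule.
- exact: Okada_refl.
- exact: Okada_sym.
exact: Okada_trans.
Qed.

Definition okada_rel N : rel (seq 'I_N.-1) := fun u v => `[< okada_cong u v >].

Lemma okada_rel_refl N : reflexive (@okada_rel N).
Proof. by move=> u; apply/asboolP; exact: Okada_refl. Qed.

Lemma okada_rel_sym N : symmetric (@okada_rel N).
Proof. by move=> u v; apply/asboolP/asboolP; exact: Okada_sym. Qed.

Lemma okada_rel_trans N : transitive (@okada_rel N).
Proof.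
move=> v u w /asboolP uv /asboolP vw.
by apply/asboolP; exact: Okada_trans uv vw.
Qed.

Canonical okada_equiv N :=
  EquivRel (@okada_rel N) (@okada_rel_refl N) (@okada_rel_sym N)
    (@okada_rel_trans N).

(* Words in the generators modulo the defining relations. *)
Definition okada_monoid N := {eq_quot (@okada_rel N)}%qT.

HB.instance Definition _ N := Choice.on (okada_monoid N).

Local Open Scope quotient_scope.

Definition okada_class N (u : seq 'I_N.-1) : okada_monoid N := \pi_(okada_monoid N) u.

Lemma okada_classP N (u v : seq 'I_N.-1) :
  okada_class u = okada_class v <-> okada_cong u v.
Proof.
split=> [H|/asboolP H]; last exact/eqmodP.
by apply/asboolP; exact/(@eqmodP _ (okada_equiv N) u v).
Qed.

Definition okada_mul N (x y : okada_monoid N) : okada_monoid N :=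
  okada_class (repr x ++ repr y).

Lemma okada_mul_class N (u v : seq 'I_N.-1) :
  okada_mul (okada_class u) (okada_class v) = okada_class (u ++ v).
Proof.
have reprC (w : seq 'I_N.-1) : okada_cong (repr (okada_class w)) w.
  by apply/okada_classP; rewrite /okada_class reprK.
apply/okada_classP; apply: (@Okada_trans _ _ (u ++ repr (okada_class v))).
  exact: (okada_cong_ctx [::] (repr (okada_class v)) (reprC u)).
by have := okada_cong_ctx u [::] (reprC v); rewrite !cats0.
Qed.

Lemma okada_class_surj N (x : okada_monoid N) : exists u, x = okada_class u.
Proof. by exists (repr x); rewrite /okada_class reprK. Qed.

Lemma okada_mulA N : associative (@okada_mul N).
Proof.
move=> x y z; have [u ->] := okada_class_surj x.
have [v ->] := okada_class_surj y; have [w ->] := okada_class_surj z.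
by rewrite !okada_mul_class catA.
Qed.

Lemma okada_1mul N : left_id (@okada_class N [::]) (@okada_mul N).
Proof.
by move=> x; have [u ->] := okada_class_surj x; rewrite okada_mul_class.
Qed.

Lemma okada_mul1 N : right_id (@okada_class N [::]) (@okada_mul N).
Proof.
by move=> x; have [u ->] := okada_class_surj x; rewrite okada_mul_class cats0.
Qed.

HB.instance Definition _ N :=
  isMonoid.Build (okada_monoid N) (@okada_mulA N) (@okada_1mul N) (@okada_mul1 N).

Definition okada_gen N (i : 'I_N.-1) : okada_monoid N := okada_class [:: i].

(* The entry c_(i+1) of the code: k and i are 0-based. *)
Definition code N (sigma : 'S_N) (i : 'I_N) : nat :=
  #|[set k : 'I_N | (k < i) && ((sigma^-1)%g i < (sigma^-1)%g k)]|.

(* The junk value 1 is never reached in code_prod, where k < code sigma i <= i. *)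
Definition gen_at N (M : monoidType) (g : 'I_N.-1 -> M) (j : nat) : M :=
  oapp g 1%g (insub j).

(* The inner product is g_i g_(i-1) ... g_(i+1-c), c = c_(i+1), when generators
   are numbered from 1; index i - k.+1 is the 0-based number of g_(i-k). *)
Definition code_prod N (M : monoidType) (g : 'I_N.-1 -> M) (sigma : 'S_N) : M :=
  (\prod_(i < N) \prod_(k < code sigma i) gen_at g (i - k.+1))%g.

(* Main.v *)
Require Import Defs.
From HB Require Import structures.
From mathcomp Require Import fingroup perm all_boot.
From mathcomp Require Import zify.
From mathcomp Require boolp.

(** Write D(M, c) for the product g_(M-1) g_(M-2) ... g_(M-c) of c consecutive
    generators with decreasing numbers (numbered from 0), and call a product
    D(0, c_0) D(1, c_1) ... D(m-1, c_(m-1)) with c_i <= i a staircase.  The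
    codes of the permutations of N points are exactly the sequences with
    c_i <= i (perm_of_code), so that the elements attached to permutations are
    exactly the staircases with N factors.  The theorem is a comparison of what
    staircases do on both sides.

    In the Okada monoid, the defining relations suffice to rewrite a staircase
    times a generator as a staircase (staircase_form_mul); hence every element
    is a staircase.  In particular the requirement on Theta determines it.
    As the diagrams A_i satisfy the defining relations (arc_gen_idem,
    arc_gen_comm, arc_gen_braid), there is a morphism with e_i |-> A_i, and it
    meets that requirement.  It remains to see that each diagram is
    the staircase of exactly one sequence c.

    Suppose that all nodes of index at least M in a diagram E are on vertical
    arcs with their largest label.  Multiplying E on the right by D(M, c) moves
    the vertical arc of index M step by step along the boundary: the arc joining
    M to bar M becomes a short arc whose two ends are consecutive in the order
    M, bar M, bar (M-1), ..., bar 0.  Each step shifts it by one place, while the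
    arc that ended at the node jumped over now ends two places earlier and keeps
    its label.  After c steps the short arc sits at place c; this is the
    predicate pocket.  Each step can be undone (capK, uncapK, uncap_okada).
    Finally, every diagram that is vertical above M has a pocket at one and only
    one place: the first place of the list whose label is too large for the end
    of an arc that has been jumped over (pocket_exists, pocket_uniq).  Peeling
    off the factors from the last to the first thus reads c off the diagram:
    staircases exhaust all diagrams (vertical_staircase_form) without repetition
    (staircase_inj). *)

Set Implicit Arguments.
Unset Strict Implicit.
Unset Printing Implicit Defensive.

(** * Staircase normal forms *)

Definition apart (i j : nat) := (i.+1 < j) || (j.+1 < i).

Section Staircase.
Variables (G : monoidType) (g : nat -> G).
Implicit Types (c : nat -> nat) (x y : G).

Definition descent m r : G := (\prod_(k < r) g (m - k.+1))%g.
Definition staircase c m : G := (\prod_(i < m) descent i (c i))%g.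

Lemma descent0 m : descent m 0 = 1%g. Proof. exact: big_ord0. Qed.

Lemma descentS m r : descent m r.+1 = (descent m r * g (m - r.+1))%g.
Proof. exact: big_ord_recr. Qed.

Lemma descentD m r s : descent m (r + s) = (descent m r * descent (m - r) s)%g.
Proof.
elim: s => [|s IH]; first by rewrite addn0 descent0 mulg1.
by rewrite addnS !descentS IH mulgA; congr (_ * g _)%g; lia.
Qed.

Lemma staircaseS c m : staircase c m.+1 = (staircase c m * descent m (c m))%g.
Proof. exact: big_ord_recr. Qed.

Lemma eq_staircase c c' m : (forall i, i < m -> c i = c' i) ->
  staircase c m = staircase c' m.
Proof. by move=> E; apply: eq_bigr => i _; rewrite E. Qed.

Definition staircase_form m x := exists2 c, (forall i, c i <= i) & x = staircase c m.

Lemma staircase_form1 m : staircase_form m 1%g.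
Proof.
exists (fun=> 0) => //; rewrite /staircase big1 // => i _; exact: descent0.
Qed.

Lemma staircase_formS m r x : r <= m -> staircase_form m x ->
  staircase_form m.+1 (x * descent m r)%g.
Proof.
move=> rm [c cle ->]; exists (fun i => if i == m then r else c i).
  by move=> i; case: eqP => [->|].
rewrite staircaseS eqxx; congr (_ * _)%g; apply: eq_staircase => i im.
by rewrite ltn_eqF.
Qed.

Variable n : nat.
Hypothesis g_idem : forall j, (g j * g j = g j)%g.
Hypothesis g_comm : forall i j, apart i j -> (g i * g j = g j * g i)%g.
Hypothesis g_braid : forall j, j.+1 < n -> (g j.+1 * g j * g j.+1 = g j.+1)%g.

Lemma descent_comm m r j : (forall k, k < r -> apart (m - k.+1) j) ->
  (descent m r * g j = g j * descent m r)%g.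
Proof.
elim: r => [|r IH] H; first by rewrite descent0 mul1g mulg1.
rewrite descentS -mulgA g_comm; last exact: H.
by rewrite !mulgA IH // => k kr; apply: H; apply: leqW.
Qed.

Lemma descent_comm_descent m r p s :
    (forall k l, k < r -> l < s -> apart (m - k.+1) (p - l.+1)) ->
  (descent m r * descent p s = descent p s * descent m r)%g.
Proof.
elim: s => [|s IH] H; first by rewrite descent0 mul1g mulg1.
rewrite descentS mulgA IH => [|k l kr ls]; last by apply: H => //; apply: leqW.
by rewrite -!mulgA descent_comm // => k kr; apply: H.
Qed.

(** The row contains g_j g_(j-1), and the trailing g_j commutes with what
    follows them; so g_j g_(j-1) g_j collapses to g_j, which cuts the row into
    the part from m - 1 down to j and the part below j - 1.  These two parts
    commute, their numbers being at least 2 apart. *)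
Lemma descent_absorb m r j : j < m <= n -> m < j + r -> r <= m ->
  (descent m r * g j = descent j.-1 (j + r - m.+1) * descent m (m - j))%g.
Proof.
move=> /andP[jm mn] mr rm.
have -> : descent m (m - j) = (descent m (m - j.+1) * g j)%g.
  by rewrite -[m - j]subnSK // descentS subnSK //; congr (_ * g _)%g; lia.
set a := m - j.+1; set s := j + r - m.+1.
have -> : r = a + s.+2 by rewrite /a /s; lia.
have -> : descent m (a + s.+2) = (descent m a * (g j * g j.-1 * descent j.-1 s))%g.
  rewrite descentD -[s.+2]/(2 + s) descentD; congr (_ * (_ * descent _ _))%g.
    by rewrite 2!descentS descent0 mul1g; congr (g _ * g _)%g; rewrite /a; lia.
  by rewrite /a; lia.
rewrite -!mulgA (descent_comm (r := s)); last by move=> k ks; rewrite /apart; lia.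
have -> : (descent m a * (g j * (g j.-1 * (g j * descent j.-1 s))) =
           descent m a * (g j * g j.-1 * g j) * descent j.-1 s)%g by rewrite !mulgA.
have -> : (g j * g j.-1 * g j = g j)%g.
  have jE : j.-1.+1 = j by lia.
  by have := @g_braid j.-1; rewrite jE; apply; lia.
rewrite -mulgA -descent_comm; last by move=> k ks; rewrite /apart; lia.
by rewrite !mulgA descent_comm_descent // => k l; rewrite /apart /a /s; lia.
Qed.

(** Only the last row D(m, r) meets g_j.  According to the place of j, the row
    gets longer by one factor, is unchanged by idempotence, or lets pass to its
    left either g_j or the part cut off in descent_absorb.  What passes to the
    left has numbers small enough for the induction on m. *)
Lemma staircase_form_mul m x j : j.+1 < m <= n.+1 -> staircase_form m x ->
  staircase_form m (x * g j)%g.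
Proof.
elim: m x j => // m IH x j /andP[jm mn] [c cle ->]; rewrite staircaseS.
have nm : staircase_form m (staircase c m) by exists c.
move: (c m) (cle m) (staircase c m) nm => r rm y ny; rewrite -mulgA.
have [H|H|H] := ltngtP (j + r) m.
- have [H1|H1] := eqVneq (j.+1 + r) m.
    have -> : j = m - r.+1 by lia.
    by rewrite -descentS; apply: staircase_formS => //; lia.
  rewrite descent_comm; last by move=> k kr; rewrite /apart; lia.
  by rewrite mulgA; apply: staircase_formS => //; apply: IH => //; lia.
- rewrite descent_absorb; [|lia..].
  rewrite mulgA; apply: staircase_formS; first lia.
  have: j + r - m.+1 < j by lia.
  elim: (j + r - m.+1) => [|s IHs] sj; first by rewrite descent0 mulg1.
  rewrite descentS mulgA; apply: IH; first lia.
  by apply: IHs; lia.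
have -> : r = (m - j.+1).+1 by lia.
rewrite descentS; have -> : m - (m - j.+1).+1 = j by lia.
rewrite -mulgA g_idem.
have := descentS m (m - j.+1); have -> : m - (m - j.+1).+1 = j by lia.
by move=> <-; apply: staircase_formS => //; lia.
Qed.
End Staircase.

(** * Every sequence below the diagonal is a code *)

Lemma index_insert (T : eqType) (x y : T) (s : seq T) k : x != y -> y \in s ->
  index y (take k s ++ x :: drop k s) = index y s + (k <= index y s).
Proof.
move=> xy ys; have us := cat_take_drop k s.
rewrite -[in RHS]us !index_cat /= (negPf xy).
have [yt|yt] := boolP (y \in take k s).
  have := index_mem y (take k s); rewrite yt size_take_min; lia.
have kt : k <= size s.
  rewrite leqNgt; apply: contra yt => ks; rewrite take_oversize //; exact: ltnW.
by rewrite size_takel //; lia.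
Qed.

(** The list is built by inserting m into a list of 0, ..., m - 1 so that
    exactly c m entries follow it.  Inserting a larger entry later does not
    change the relative order of the entries already present. *)
Lemma list_of_code (c : nat -> nat) m : (forall i, c i <= i) ->
  exists2 s, perm_eq s (iota 0 m) &
    forall i, i < m ->
      count (fun k => (k < i) && (index i s < index k s)) (iota 0 m) = c i.
Proof.
move=> cle; elim: m => [|m [s ps sE]]; first by exists [::].
have iotaS1 : iota 0 m.+1 = iota 0 m ++ [:: m] by rewrite -addn1 iotaD.
have us : uniq s by rewrite (perm_uniq ps) iota_uniq.
have ms : m \notin s by rewrite (perm_mem ps) mem_iota; lia.
have sz : size s = m by rewrite (perm_size ps) size_iota.
have si k : k < m -> k \in s by rewrite (perm_mem ps) mem_iota; lia.
have cm := cle m.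
exists (take (m - c m) s ++ m :: drop (m - c m) s).
  rewrite iotaS1 /= perm_catC perm_sym perm_catC /= perm_cons.
  by rewrite perm_sym perm_catC cat_take_drop.
move=> i; rewrite ltnS leq_eqVlt => /orP[/eqP->|im]; last first.
  rewrite -(sE i im) iotaS1 count_cat /= addn0.
  have -> : (m < i) = false by lia.
  rewrite addn0; apply: eq_in_count => k; rewrite mem_iota /= => km.
  rewrite !index_insert ?si //; first (by lia); lia.
have im : index m (take (m - c m) s ++ m :: drop (m - c m) s) = m - c m.
  rewrite index_cat (negPf (contra (@mem_take _ _ _ _) ms)) /= eqxx addn0.
  by rewrite size_takel // sz leq_subr.
rewrite iotaS1 count_cat /= ltnn addn0 im.
rewrite (eq_in_count (a2 := fun k => m - c m <= index k s)); last first.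
  move=> k; rewrite mem_iota /= => km; rewrite km index_insert ?si //; lia.
rewrite -(permP ps) -[in X in count _ X](cat_take_drop (m - c m) s) count_cat.
have idx k : k \in s -> (m - c m <= index k s) = (k \notin take (m - c m) s).
  move=> ks; rewrite in_take_leq ?sz ?leq_subr // -leqNgt //.
rewrite (eq_in_count (a2 := pred0)) => [|k kt]; last first.
  by rewrite idx ?kt // (mem_take kt).
rewrite (eq_in_count (a2 := predT) (s := drop _ _)) => [|k kd].
  by rewrite count_pred0 count_predT size_drop sz; lia.
rewrite idx ?(mem_drop kd) //; apply/negP => kt.
have := us; rewrite -(cat_take_drop (m - c m) s) cat_uniq => /and3P[_ /hasPn/(_ k kd)].
by rewrite /= kt.
Qed.

(** The inverse of the permutation sends k to its place in the list of
    list_of_code. *)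
Lemma perm_of_code N (c : nat -> nat) : (forall i, c i <= i) ->
  exists sigma : 'S_N, forall i : 'I_N, code sigma i = c i.
Proof.
move=> cle; have [s ps sE] := list_of_code N cle.
have sz : size s = N by rewrite (perm_size ps) size_iota.
have si (k : 'I_N) : (k : nat) \in s by rewrite (perm_mem ps) mem_iota /= ltn_ord.
have idx (k : 'I_N) : index (k : nat) s < N by rewrite -[X in _ < X]sz index_mem.
have inj : injective (fun k : 'I_N => Ordinal (idx k)).
  move=> k l [] E; apply: val_inj.
  by rewrite /= -[LHS](nth_index 0 (si k)) E nth_index.
exists (perm inj)^-1%g => i; rewrite -(sE i) // /code invgK cardE size_filter.
rewrite -[iota 0 N]val_enum_ord count_map enumT.
by apply: eq_count => k; rewrite !inE !permE.
Qed.

(** * Right multiplication of a diagram by a generator *)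

Section Feet.
Variables (N : nat) (i : 'I_N.-1).

Definition foot_lo : node N := (true, ord_lo i).
Definition foot_hi : node N := (true, ord_hi i).

(** The feet are the two barred nodes where a diagram on the left meets the
    unbarred short arc of the generator. *)
Definition foot (z : node N) := (z == foot_lo) || (z == foot_hi).
Definition other_foot (z : node N) := if z == foot_lo then foot_hi else foot_lo.

Lemma footE z : foot z = z.1 && ((z.2 == i :> nat) || (z.2 == i.+1 :> nat)).
Proof. by case: z => [[] j]. Qed.

Lemma foot_lo_neq_hi : foot_lo == foot_hi = false.
Proof. by apply/negbTE/eqP => -[]; lia. Qed.

Lemma foot_hi_neq_lo : foot_hi == foot_lo = false.
Proof. by rewrite eq_sym foot_lo_neq_hi. Qed.

Lemma footP z : reflect (z = foot_lo \/ z = foot_hi) (foot z).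
Proof. by apply: (iffP orP) => -[]/eqP; tauto. Qed.

Lemma foot_other z : foot (other_foot z).
Proof. by rewrite /foot /other_foot; case: ifP => _; rewrite eqxx ?orbT. Qed.

Lemma other_foot_lo : other_foot foot_lo = foot_hi.
Proof. by rewrite /other_foot eqxx. Qed.

Lemma other_foot_hi : other_foot foot_hi = foot_lo.
Proof. by rewrite /other_foot foot_hi_neq_lo. Qed.

Lemma other_footK z : foot z -> other_foot (other_foot z) = z.
Proof. by case/footP => ->; rewrite ?(other_foot_lo, other_foot_hi). Qed.

Lemma other_foot_neq z : other_foot z != z.
Proof.
rewrite /other_foot; have [->|] := eqVneq z foot_lo; first by rewrite foot_hi_neq_lo.
by rewrite eq_sym.
Qed.

Lemma foot_cases z t : foot z -> foot t -> t = z \/ t = other_foot z.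
Proof.
by move=> /footP[]-> /footP[]->; rewrite ?(other_foot_lo, other_foot_hi); tauto.
Qed.

(** The product of D with the generator, in closed form.  On the barred side the
    feet are tied by the short arc of the generator.  The two arcs of D that end
    at the feet are concatenated by its other short arc, whose label is at
    least that of the arc of D at foot_lo and so never counts in the minimum.
    If D itself ties its feet, that arc closes up to a loop and disappears
    with its label. *)
Definition cap_diag (D : prediag N) : prediag N :=
  ([ffun z => if foot z then other_foot z else
      if foot (mate D z) then mate D (other_foot (mate D z)) else mate D z],
   [ffun z => if foot z then i.+1 else
      if foot (mate D z) then minn (lab D foot_lo) (lab D foot_hi)
      else lab D z]).

Lemma cap_mateE D z : mate (cap_diag D) z =
  if foot z then other_foot z else
    if foot (mate D z) then mate D (other_foot (mate D z)) else mate D z.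
Proof. by rewrite /mate ffunE. Qed.

Lemma cap_labE D z : lab (cap_diag D) z =
  if foot z then i.+1 else
    if foot (mate D z) then minn (lab D foot_lo) (lab D foot_hi) else lab D z.
Proof. by rewrite /lab ffunE. Qed.

Lemma gen_mateE (z : node N) : mate (gen_diag i) z =
  if z.2 == ord_lo i then (z.1, ord_hi i)
  else if z.2 == ord_hi i then (z.1, ord_lo i) else (~~ z.1, z.2).
Proof. by rewrite /mate ffunE. Qed.

Lemma gen_labE (z : node N) : lab (gen_diag i) z =
  if (z.2 == ord_lo i) || (z.2 == ord_hi i) then i.+1 else absn z.
Proof. by rewrite /lab ffunE. Qed.

Lemma gen_mate_foot z : foot z -> mate (gen_diag i) z = other_foot z /\
  mate (gen_diag i) (false, z.2) = (false, (other_foot z).2).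
Proof.
have hl : (ord_hi i == ord_lo i) = false.
  by have := foot_hi_neq_lo; rewrite xpair_eqE.
case/footP => ->; rewrite !gen_mateE /= ?eqxx ?hl ?other_foot_lo //.
by rewrite other_foot_hi.
Qed.

Lemma gen_mate_nfoot j : ~~ foot (true, j) ->
  mate (gen_diag i) (true, j) = (false, j) /\
  mate (gen_diag i) (false, j) = (true, j).
Proof.
rewrite !gen_mateE /= => /norP[/negPf nlo /negPf nhi].
by move: nlo nhi; rewrite !xpair_eqE /= => -> ->.
Qed.
End Feet.

Section OkadaFacts.
Variables (N : nat) (D : prediag N).
Hypothesis oD : okada_arc D.

Lemma okada_mateK : involutive (mate D).
Proof. by case/okadaP: oD => /matchingP[]. Qed.

Lemma okada_mateN z : mate D z != z.
Proof. by case/okadaP: oD => /matchingP[]. Qed.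

Lemma okada_lab_mate z : lab D (mate D z) = lab D z.
Proof. by case/okadaP: oD => _ _ /(_ z)[]. Qed.

Lemma okada_lab_gt0 z : 0 < lab D z.
Proof. by case/okadaP: oD => _ _ /(_ z)[]. Qed.

Lemma okada_lab_le z : lab D z <= absn z.
Proof. by case/okadaP: oD => _ _ /(_ z)[_ _]; rewrite leq_min => /andP[]. Qed.

Lemma okada_mate_eq z t : (mate D z == t) = (z == mate D t).
Proof. by rewrite -(inj_eq (inv_inj okada_mateK)) okada_mateK. Qed.
End OkadaFacts.

Section RightMul.
Variables (N : nat) (i : 'I_N.-1) (D : prediag N).
Hypothesis oD : okada_arc D.
Local Notation foot := (foot i).
Local Notation other := (other_foot i).
Local Notation m' := (mate (cap_diag i D)).

Let mK := okada_mateK oD.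
Let mN := okada_mateN oD.
Let mGen : matching (gen_diag i). Proof. by case/okadaP: (gen_okada i). Qed.
Let mD : matching D. Proof. by case/okadaP: oD. Qed.

Let G := stacked D (gen_diag i).

Let conn_inl z : ~~ foot z -> connect G (outer z) (inl z).
Proof.
case: z => [[] j] cz; last exact: connect0.
have := step_glue (step_strand (connect0 G (outer (true, j)))).
by rewrite /= (gen_mate_nfoot cz).1.
Qed.

Let conn_outl z : ~~ foot z -> connect G (inl z) (outer z).
Proof. by move=> cz; rewrite (conn_sym mD mGen) conn_inl. Qed.

Let conn_other z : foot z -> connect G (inl z) (inl (other z)).
Proof.
move=> cz; have [_] := gen_mate_foot cz.
have := foot_other i z; have := step_glue (connect0 G (inl z)).
case: z cz => [[] j]; last by rewrite footE.
case: (other (true, j)) => [[] k] _; last by rewrite footE.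
by move=> cz _ E; have := step_glue (step_strand cz); rewrite /= E.
Qed.

Let conn_mate z : connect G (inl z) (inl (mate D z)).
Proof. exact: (step_strand (connect0 G (inl z))). Qed.

Lemma cap_mate_nfoot z : ~~ foot z -> ~~ foot (m' z).
Proof.
move=> cz; rewrite cap_mateE (negPf cz); case: ifP => [cm|->//].
apply: contra cz => /(foot_cases (foot_other i (mate D z)))[/eqP|].
  by rewrite (negPf (mN _)).
by rewrite other_footK // => /(inv_inj mK) <-; exact: foot_other.
Qed.

(** Below, P o is closed under strands and links and contains the end o, hence
    contains the whole path of the stack that starts at o; this bounds the label
    of that path from below. *)
Lemma mul_gen_diag : diag_mul D (gen_diag i) = cap_diag i D.
Proof.
pose P1 o t := if foot t then ~~ foot o && foot (mate D o)
               else (t == o) || (t == m' o).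
pose P o (z : node N + node N) := match z with
  | inl t => P1 o t
  | inr (true, k) => ((true, k) == o) || ((true, k) == m' o)
  | inr (false, k) => P1 o (true, k) end.
have P1m o t : P1 o t -> P1 o (mate D t).
  rewrite /P1; have [ct /andP[co cmo]|ct] := boolP (foot t).
    have [->|->] := foot_cases cmo ct; first by rewrite mK (negPf co) eqxx.
    have -> : mate D (other (mate D o)) = m' o.
      by rewrite cap_mateE (negPf co) cmo.
    by rewrite (negPf (cap_mate_nfoot co)) eqxx orbT.
  case/orP => /eqP E.
    rewrite E in ct *; case: ifP => [->|cmo]; first by rewrite ct.
    by rewrite (cap_mateE _ D) (negPf ct) cmo eqxx orbT.
  have co : ~~ foot o.
    by apply: contra ct => co; rewrite E cap_mateE co foot_other.
  have := cap_mateE i D o; rewrite (negPf co) -E.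
  case: ifP => [cmo|cmo] ->; rewrite mK; first by rewrite foot_other.
  by rewrite (negPf co) eqxx.
apply: (@diag_mul_eq N _ _ _ P) => //.
- move=> z; have [cz|cz] := boolP (foot z).
    by rewrite cap_mateE cz other_foot_neq.
  rewrite cap_mateE (negPf cz); case: ifP => // _.
  by rewrite okada_mate_eq // other_foot_neq.
- move=> z; have [cz|cz] := boolP (foot z).
    have [E _] := gen_mate_foot cz.
    have := foot_other i z; have := cz; have := step_strand (connect0 G (outer z)).
    rewrite cap_mateE cz; case: z cz E => [[] j]; last by rewrite footE.
    case: (other _) => [[] k] _ E C; rewrite !footE //= => _ _.
    by move: C; rewrite /= E.
  apply: connect_trans (conn_outl (cap_mate_nfoot cz)).
  apply: connect_trans (conn_inl cz) _; apply: connect_trans (conn_mate z) _.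
  rewrite cap_mateE (negPf cz); case: ifP => [cm|_]; last exact: connect0.
  exact: connect_trans (conn_other cm) (conn_mate _).
- move=> z; have [cz|cz] := boolP (foot z).
    exists (outer z); first exact: connect0.
    by rewrite cap_labE cz; case/footP: cz => ->; rewrite /= gen_labE eqxx ?orbT.
  rewrite cap_labE (negPf cz); case: ifP => [cm|_]; last first.
    by exists (inl z) => //; exact: conn_inl.
  have C : connect G (outer z) (inl (mate D z)).
    exact: connect_trans (conn_inl cz) (conn_mate z).
  have [zl zh] : connect G (outer z) (inl (foot_lo i)) /\
                 connect G (outer z) (inl (foot_hi i)).
    case/footP: (cm) C => E; rewrite E => C; split=> //; apply: connect_trans C _.
      by rewrite -(other_foot_lo i) conn_other // -E.
    by rewrite -(other_foot_hi i) conn_other // -E.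
  by rewrite /minn; case: ifP => _;
    [exists (inl (foot_lo i)) | exists (inl (foot_hi i))].
- by move=> [[] j]; rewrite /= /P1 ?footE /= ?eqxx.
- move=> o [t|[[] k]] /= Pz; split=> //.
  + exact: P1m.
  + by case: t Pz => [[] k].
  + have [ck|ck] := boolP (foot (true, k)); last first.
      by rewrite (gen_mate_nfoot ck).1 /P1 (negPf ck).
    have [-> _] := gen_mate_foot ck.
    have := foot_other i (true, k); case E: (other _) => [[] k'] // _.
    rewrite -E; case/orP: Pz => /eqP Eo.
      by rewrite -Eo [in X in _ || X]cap_mateE ck eqxx orbT.
    have co : foot o by apply: contraLR ck => /cap_mate_nfoot; rewrite -Eo.
    by move: Eo; rewrite [in X in X -> _]cap_mateE co => ->; rewrite other_footK ?eqxx.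
  + have [ck|ck] := boolP (foot (true, k)); last first.
      by rewrite (gen_mate_nfoot ck).2; move: Pz; rewrite /P1 (negPf ck).
    have [_ /= ->] := gen_mate_foot ck.
    have := foot_other i (true, k); case: (other _) => [[] k']; last by rewrite footE.
    by move: Pz; rewrite /P1 /= ck => ? ->.
have min_le t : foot t -> minn (lab D (foot_lo i)) (lab D (foot_hi i)) <= lab D t.
  by case/footP => ->; rewrite geq_min leqnn ?orbT.
have labM o t : ~~ foot o -> (t == o) || (t == m' o) ->
    lab (cap_diag i D) o <= lab D t.
  move=> co; rewrite cap_labE (negPf co); case/orP => /eqP->.
    by case: ifP => // cm; rewrite -(okada_lab_mate oD o) min_le.
  rewrite cap_mateE (negPf co); have [cm|cm] := boolP (foot (mate D o)).
    by rewrite okada_lab_mate // min_le // foot_other.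
  by rewrite okada_lab_mate.
have labP1 o t : P1 o t -> lab (cap_diag i D) o <= lab D t.
  rewrite /P1; have [ct /andP[co cmo]|ct] := boolP (foot t).
    by rewrite cap_labE (negPf co) cmo min_le.
  move=> H; apply: labM => //; case/orP: H => /eqP E; first by rewrite -E.
  by apply: contra ct => co; rewrite E cap_mateE co foot_other.
have glab s k : lab (gen_diag i) (s, k) = if foot (true, k) then i.+1 else k.+1.
  by rewrite gen_labE footE /absn.
have labI o k : P1 o (true, k) ->
    lab (cap_diag i D) o <= lab (gen_diag i) (false, k).
  move=> Po; rewrite glab; have [ck|ck] := boolP (foot (true, k)); last first.
    exact: leq_trans (labP1 _ _ Po) (okada_lab_le oD _).
  move: Po; rewrite /P1 ck cap_labE => /andP[/negPf -> ->].
  by rewrite geq_min (okada_lab_le oD (foot_lo i)).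
move=> o [t|[[] k]] /= Pz; [exact: labP1| |exact: labI].
have [ck|ck] := boolP (foot (true, k)).
  rewrite glab ck; suff co : foot o by rewrite cap_labE co.
  case/orP: Pz => /eqP Eo; first by rewrite -Eo.
  by apply: contraLR ck => /cap_mate_nfoot; rewrite -Eo.
by have := labI o k; rewrite /P1 (negPf ck) !glab => /(_ Pz).
Qed.
End RightMul.

(** * The generating diagrams satisfy the Okada relations *)

Lemma arc_mul_gen N (C : arc_monoid N) i : arc_val (C * arc_gen i)%g = cap_diag i C.
Proof. exact: mul_gen_diag (arc_valP C). Qed.

Section Absorb.
Variables (N : nat) (D : prediag N) (i : 'I_N.-1).
Hypothesis oD : okada_arc D.

Lemma cap_diag_absorb :
  mate D (foot_lo i) = foot_hi i -> lab D (foot_lo i) = i.+1 -> cap_diag i D = D.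
Proof.
move=> mlo llo.
have mf z : foot i z -> mate D z = other_foot i z.
  case/footP => ->; first by rewrite other_foot_lo.
  by rewrite other_foot_hi -mlo okada_mateK.
have mnf z : ~~ foot i z -> ~~ foot i (mate D z).
  apply: contra => mz; rewrite -(okada_mateK oD z) mf //; exact: foot_other.
apply: prediag_eq => z; rewrite ?cap_mateE ?cap_labE.
  by case: ifP => [/mf //|/negbT/mnf/negPf->].
case: ifP => [/footP[]->|/negbT/mnf/negPf->] //.
by rewrite -mlo okada_lab_mate.
Qed.

(** If D ties the feet of the generator j = i + 1, multiplying by the generator
    i slides that short arc by one place, and multiplying by the generator j
    slides it back.  The arc that was jumped over ends at foot_lo i, so its label
    is at most i + 1 and survives both minima.  Applied to D = A_j, this is the
    relation A_j A_i A_j = A_j. *)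
Lemma cap_diag_zigzag (j : 'I_N.-1) : j = i.+1 :> nat ->
  mate D (foot_lo j) = foot_hi j -> lab D (foot_lo j) = j.+1 ->
  cap_diag j (cap_diag i D) = D.
Proof.
move=> ji mlo llo.
have hl : foot_hi i = foot_lo j by congr (_, _); apply: val_inj.
have mhi : mate D (foot_hi j) = foot_lo j by rewrite -mlo okada_mateK.
have fi_lo : foot i (foot_lo j) by rewrite -hl /foot eqxx orbT.
have nfi_hi : foot i (foot_hi j) = false by rewrite footE /=; lia.
have nfj_lo : foot j (foot_lo i) = false by rewrite footE /=; lia.
have mu_nj : foot j (mate D (foot_lo i)) = false.
  apply/negbTE/negP => /footP[]/(congr1 (mate D));
    rewrite okada_mateK // ?mlo ?mhi => E.
    by move: nfj_lo; rewrite E /foot eqxx orbT.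
  by move: nfj_lo; rewrite E /foot eqxx.
have llm : lab D (foot_lo i) <= lab D (foot_hi i).
  by rewrite hl llo (leq_trans (okada_lab_le oD _)) // /absn /= ji.
have lhi : lab D (foot_hi j) = j.+1 by rewrite -mlo okada_lab_mate.
have ch : mate (cap_diag i D) (foot_hi j) = mate D (foot_lo i).
  by rewrite cap_mateE nfi_hi mhi fi_lo -hl other_foot_hi.
have cl : mate (cap_diag i D) (foot_lo j) = foot_lo i.
  by rewrite cap_mateE fi_lo -hl other_foot_hi.
have lh : lab (cap_diag i D) (foot_hi j) = lab D (foot_lo i).
  by rewrite cap_labE nfi_hi mhi fi_lo (minn_idPl llm).
have ll : lab (cap_diag i D) (foot_lo j) = i.+1 by rewrite cap_labE fi_lo.
have lmin : minn (lab (cap_diag i D) (foot_lo j)) (lab (cap_diag i D) (foot_hi j))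
  = lab D (foot_lo i).
  by rewrite ll lh; apply/minn_idPr; exact: okada_lab_le.
have lo_hi : other_foot j (foot_lo j) = foot_hi j by exact: other_foot_lo.
have hi_lo : other_foot j (foot_hi j) = foot_lo j by exact: other_foot_hi.
have fjl : foot j (foot_lo j) by rewrite /foot eqxx.
have fjh : foot j (foot_hi j) by rewrite /foot eqxx orbT.
have outside z : ~~ foot j z ->
    [\/ z = foot_lo i, mate D z = foot_lo i |
       [/\ ~~ foot i z, ~~ foot i (mate D z) & ~~ foot j (mate D z)]].
  move=> zj; have [/footP[]|zi] := boolP (foot i z); first by constructor 1.
    by move=> E; rewrite E hl fjl in zj.
  have [/footP[]|mzi] := boolP (foot i (mate D z)); first by constructor 2.
    by rewrite hl -mhi => /(inv_inj (okada_mateK oD)) E; rewrite E fjh in zj.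
  constructor 3; split=> //; apply: contra zj => /footP[]/(congr1 (mate D));
    by rewrite okada_mateK // ?mlo ?mhi => ->.
have foot_lo_i : foot i (foot_lo i) by rewrite /foot eqxx.
apply: prediag_eq => z.
  rewrite (cap_mateE j); have [/footP[]->|zj] := boolP (foot j z);
    rewrite ?lo_hi ?hi_lo //.
  have [->|E|[zi mzi mzj]] := outside z zj.
  - have -> : mate (cap_diag i D) (foot_lo i) = foot_lo j.
      by rewrite cap_mateE foot_lo_i other_foot_lo hl.
    by rewrite fjl lo_hi ch.
  - have zi : ~~ foot i z.
      apply: contra zj => /footP[Ez|->]; last by rewrite hl.
      by have /eqP := okada_mateN oD z; rewrite E Ez.
    have -> : mate (cap_diag i D) z = foot_hi j.
      by rewrite cap_mateE (negPf zi) E foot_lo_i other_foot_lo hl mlo.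
    by rewrite fjh hi_lo cl.
  have -> : mate (cap_diag i D) z = mate D z.
    by rewrite cap_mateE (negPf zi) (negPf mzi).
  by rewrite (negPf mzj).
rewrite (cap_labE j); have [/footP[]->|zj] := boolP (foot j z);
  rewrite ?llo ?lhi ?lmin //.
have [->|E|[zi mzi mzj]] := outside z zj.
- by rewrite (cap_mateE i) foot_lo_i other_foot_lo hl fjl.
- have zi : ~~ foot i z.
    apply: contra zj => /footP[Ez|->]; last by rewrite hl.
    by have /eqP := okada_mateN oD z; rewrite E Ez.
  rewrite cap_mateE (negPf zi) E foot_lo_i other_foot_lo hl mlo fjh.
  by rewrite -(okada_lab_mate oD z) E.
by rewrite cap_mateE (negPf zi) (negPf mzi) (negPf mzj) cap_labE (negPf zi) (negPf mzi).
Qed.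
End Absorb.

Section Relations.
Variable N : nat.
Implicit Types i j : 'I_N.-1.

Lemma arc_gen_idem i : (arc_gen i * arc_gen i = arc_gen i)%g.
Proof.
apply: val_inj; rewrite [LHS]arc_mul_gen; apply: cap_diag_absorb.
- exact: gen_okada.
- by rewrite gen_mateE eqxx.
by rewrite gen_labE eqxx.
Qed.

Lemma arc_gen_braid i j : j = i.+1 :> nat ->
  (arc_gen j * arc_gen i * arc_gen j = arc_gen j)%g.
Proof.
move=> ji; apply: val_inj; rewrite [LHS]arc_mul_gen arc_mul_gen.
apply: cap_diag_zigzag => //.
- exact: gen_okada.
- by rewrite gen_mateE eqxx.
by rewrite gen_labE eqxx.
Qed.

Lemma gen_mate_footE i s k : mate (gen_diag i) (s, k) =
  if foot i (true, k) then (s, (other_foot i (true, k)).2) else (~~ s, k).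
Proof.
case: ifP => [fk|/negbT/gen_mate_nfoot[E1 E2]]; last by case: s; rewrite ?E1 ?E2.
have [E1 E2] := gen_mate_foot fk; case: s => //; rewrite E1.
by have := foot_other i (true, k); rewrite footE; case: (other_foot _ _) => [[]].
Qed.

Lemma apart_sym (i j : nat) : apart i j = apart j i.
Proof. by rewrite /apart orbC. Qed.

Lemma foot_apart i j z : apart i j -> foot i z -> foot j z = false.
Proof. by rewrite /apart !footE => ij /andP[-> /=]; lia. Qed.

(** When i and j are at least 2 apart, the product A_i A_j acts on the feet of
    each generator separately, a description that is symmetric in i and j. *)
Lemma two_caps_mate i j s k : apart i j ->
  mate (cap_diag j (gen_diag i)) (s, k) =
    if foot i (true, k) then (s, (other_foot i (true, k)).2) else
    if foot j (true, k) then (s, (other_foot j (true, k)).2) else (~~ s, k).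
Proof.
move=> ij; have ji : apart j i by rewrite apart_sym.
have otherE h z : other_foot h z = (true, (other_foot h z).2).
  by have := foot_other h z; rewrite footE; case: (other_foot h z) => [[]].
rewrite cap_mateE gen_mate_footE; case: s.
  have [fi|nfi] := boolP (foot i (true, k)).
    by rewrite (foot_apart ij fi) -otherE (foot_apart ij (foot_other i _)).
  by have [fj|nfj] := boolP (foot j (true, k)); first exact: otherE.
rewrite footE /=; have [fi|nfi] := boolP (foot i (true, k)).
  by rewrite footE.
have [fj|//] := boolP (foot j (true, k)).
by rewrite otherE gen_mate_footE -otherE (foot_apart ji (foot_other j _)).
Qed.

Lemma two_caps_lab i j s k : apart i j ->
  lab (cap_diag j (gen_diag i)) (s, k) =
    if foot i (true, k) then i.+1 else if foot j (true, k) then j.+1 else k.+1.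
Proof.
move=> ij; have ji : apart j i by rewrite apart_sym.
have otherE h z : other_foot h z = (true, (other_foot h z).2).
  by have := foot_other h z; rewrite footE; case: (other_foot h z) => [[]].
have glab t l : lab (gen_diag i) (t, l) = if foot i (true, l) then i.+1 else l.+1.
  by rewrite gen_labE footE.
have nj l : foot j (true, l) -> foot i (true, l) = false by exact: foot_apart.
have flo : foot j (foot_lo j) by rewrite /foot eqxx.
have fhi : foot j (foot_hi j) by rewrite /foot eqxx orbT.
have gmin : minn (lab (gen_diag i) (foot_lo j)) (lab (gen_diag i) (foot_hi j)) = j.+1.
  by rewrite /foot_lo /foot_hi !glab !nj //; apply/minn_idPl => /=.
rewrite cap_labE gmin glab gen_mate_footE; case: s.
  have [fi|nfi] := boolP (foot i (true, k)).
    by rewrite (foot_apart ij fi) -otherE (foot_apart ij (foot_other i _)).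
  by rewrite [foot j (~~ true, k)]footE.
rewrite footE /=; have [fi|nfi //] := boolP (foot i (true, k)).
by rewrite footE.
Qed.

Lemma arc_gen_comm i j : apart i j ->
  (arc_gen i * arc_gen j = arc_gen j * arc_gen i)%g.
Proof.
move=> ij; have ji : apart j i by rewrite apart_sym.
apply: val_inj; rewrite [LHS]arc_mul_gen [RHS]arc_mul_gen /=.
apply: prediag_eq => -[s k].
  rewrite !two_caps_mate //.
  by have [fi|//] := boolP (foot i (true, k)); rewrite (foot_apart ij fi).
rewrite !two_caps_lab //.
by have [fi|//] := boolP (foot i (true, k)); rewrite (foot_apart ij fi).
Qed.

End Relations.

(** * Undoing the multiplication by a generator *)

Lemma okada_lab_odd N (C : prediag N) x : okada_arc C ->
  pos x < pos (mate C x) -> odd (lab C x) = ~~ odd (pos x).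
Proof.
by case/okadaP => mC ncC L _ lx; case: (L x) => _ _ _ ->; exact: odd_minn_absn.
Qed.

(** In a non-crossing matching, the parity of the smaller index of an arc is
    determined by the place of its first end.  Parity is thereby easy to follow
    when ends of arcs are moved by an even number of places. *)
Lemma okada_of_odd N (C : prediag N) : matching C -> noncrossing C ->
    (forall x, [/\ lab C (mate C x) = lab C x, 0 < lab C x & lab C x <= absn x]) ->
    (forall x, pos x < pos (mate C x) -> odd (lab C x) = ~~ odd (pos x)) ->
    (forall x y, nested C x y -> lab C y < lab C x) ->
  okada_arc C.
Proof.
move=> mC ncC L O nest; have /matchingP[mK mN] := mC.
apply/okadaP; split=> // x; have [lm l0 le] := L x; have [_ _ lem] := L (mate C x).
split=> //; first by rewrite leq_min le -lm lem.
have /orP[lx|lx] := pos_neq (mN x); last by rewrite odd_minn_absn // O.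
have := odd_minn_absn mC ncC (x := mate C x); have := O (mate C x).
by rewrite mK lm minnC => /(_ lx) -> ->.
Qed.

Lemma pos_foot N (i : 'I_N.-1) :
  pos (foot_lo i) = (pos (foot_hi i)).+1 /\ odd (pos (foot_hi i)) = odd i.
Proof. by rewrite /pos /=; have := ltn_ord i; split; lia. Qed.

(** The step inverse to cap_diag, for a diagram that ties the feet.  The node w is
    meant to precede foot_hi in the list M, bar M, ..., bar 0: the short arc is
    put back on w and foot_hi, and the arc that ended at w is put back on
    foot_lo. *)
Definition uncap_diag N (i : 'I_N.-1) (w : node N) (D : prediag N) : prediag N :=
  ([ffun z => if z == foot_hi i then w else if z == w then foot_hi i else
      if z == foot_lo i then mate D w else
      if mate D z == w then foot_lo i else mate D z],
   [ffun z => if (z == foot_hi i) || (z == w) then i.+2 else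
      if z == foot_lo i then lab D w else lab D z]).

Lemma uncap_mateE N (i : 'I_N.-1) w D z : mate (uncap_diag i w D) z =
  if z == foot_hi i then w else if z == w then foot_hi i else
    if z == foot_lo i then mate D w else
    if mate D z == w then foot_lo i else mate D z.
Proof. by rewrite /mate ffunE. Qed.

Lemma uncap_labE N (i : 'I_N.-1) w D z : lab (uncap_diag i w D) z =
  if (z == foot_hi i) || (z == w) then i.+2 else
    if z == foot_lo i then lab D w else lab D z.
Proof. by rewrite /lab ffunE. Qed.

Section Uncap.
Variables (N : nat) (i : 'I_N.-1) (w : node N).
Local Notation lo := (foot_lo i).
Local Notation hi := (foot_hi i).
Hypothesis wlo : w != lo.
Hypothesis whi : w != hi.

Lemma uncapK D : okada_arc D -> mate D lo = hi -> lab D lo = i.+1 ->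
  lab D w <= i.+1 -> cap_diag i (uncap_diag i w D) = D.
Proof.
move=> oD mlo llo lw; have mK := okada_mateK oD.
have mhi : mate D hi = lo by rewrite -mlo mK.
set C := uncap_diag i w D.
have Clo : mate C lo = mate D w.
  by rewrite uncap_mateE foot_lo_neq_hi eq_sym (negPf wlo) eqxx.
have Chi : mate C hi = w by rewrite uncap_mateE eqxx.
have lClo : lab C lo = lab D w.
  by rewrite uncap_labE foot_lo_neq_hi eq_sym (negPf wlo) eqxx.
have lChi : lab C hi = i.+2 by rewrite uncap_labE eqxx.
have mw : ~~ foot i (mate D w).
  apply/negP => /footP[]/(congr1 (mate D)); rewrite mK ?mlo ?mhi => E.
    by move: whi; rewrite E eqxx.
  by move: wlo; rewrite E eqxx.
have outside z : ~~ foot i z ->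
    [\/ z = w, z = mate D w | [/\ z != w, mate D z != w & ~~ foot i (mate D z)]].
  move=> zf; have [->|zw] := eqVneq z w; first by constructor 1.
  have [<-|mzw] := eqVneq (mate D z) w; first by constructor 2; rewrite mK.
  constructor 3; split=> //; apply: contra zf => /footP[]/(congr1 (mate D));
    by rewrite mK ?mlo ?mhi /foot => ->; rewrite eqxx ?orbT.
have Cw : mate C w = hi by rewrite uncap_mateE (negPf whi) eqxx.
have Cu : mate C (mate D w) = lo.
  move: mw => /norP[/negPf ul /negPf uh].
  by rewrite uncap_mateE uh (negPf (okada_mateN oD _)) ul mK eqxx.
have wf : foot i w = false by rewrite /foot (negPf wlo) (negPf whi).
have flo : foot i lo by rewrite /foot eqxx.
have fhi : foot i hi by rewrite /foot eqxx orbT.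
apply: prediag_eq => z.
  rewrite cap_mateE; have [/footP[]->|zf] := boolP (foot i z).
  - by rewrite other_foot_lo mlo.
  - by rewrite other_foot_hi mhi.
  have [->|->|[zw mzw mzf]] := outside z zf.
  - by rewrite Cw fhi other_foot_hi Clo.
  - by rewrite Cu flo other_foot_lo Chi mK.
  move: (zf) => /norP[/negPf zl /negPf zh].
  by rewrite uncap_mateE zh (negPf zw) zl (negPf mzw) (negPf mzf).
have lmin : minn (lab C lo) (lab C hi) = lab D w.
  by rewrite lClo lChi; apply/minn_idPl; apply: leqW.
rewrite cap_labE lmin; have [/footP[]->|zf] := boolP (foot i z) => //.
  by rewrite -mlo okada_lab_mate.
have [->|->|[zw mzw mzf]] := outside z zf.
- by rewrite Cw fhi.
- by rewrite Cu flo okada_lab_mate.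
move: (zf) => /norP[/negPf zl /negPf zh].
rewrite uncap_mateE zh (negPf zw) zl (negPf mzw) (negPf mzf).
by rewrite uncap_labE zh (negPf zw) zl.
Qed.

Lemma capK D : okada_arc D -> mate D hi = w -> lab D hi = i.+2 ->
  uncap_diag i w (cap_diag i D) = D.
Proof.
move=> oD mhi lhi; have mK := okada_mateK oD.
have mw : mate D w = hi by rewrite -mhi mK.
have wf : foot i w = false by rewrite /foot (negPf wlo) (negPf whi).
have flo : foot i lo by rewrite /foot eqxx.
have fhi : foot i hi by rewrite /foot eqxx orbT.
have lmin : minn (lab D lo) (lab D hi) = lab D lo.
  apply/minn_idPl; rewrite lhi; apply: leqW; exact: okada_lab_le.
apply: prediag_eq => z.
  rewrite uncap_mateE; have [->|zh] := eqVneq z hi; first by rewrite mhi.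
  have [->|zw] := eqVneq z w; first by rewrite mw.
  rewrite !cap_mateE wf mw fhi other_foot_hi.
  have [->//|zl] := eqVneq z lo.
  have -> : foot i z = false by rewrite /foot (negPf zl) (negPf zh).
  have mzh : mate D z != hi by rewrite okada_mate_eq // mhi.
  have [E|mzl] := eqVneq (mate D z) lo; first by rewrite E flo other_foot_lo mhi eqxx.
  rewrite /foot (negPf mzh) (negPf mzl) /=.
  by rewrite okada_mate_eq // mw (negPf zh).
rewrite uncap_labE; have [->//|zh] := eqVneq z hi.
have [->|zw] := eqVneq z w; first by rewrite -mhi okada_lab_mate.
rewrite /= !cap_labE wf mw fhi lmin; have [->//|zl] := eqVneq z lo.
have -> : foot i z = false by rewrite /foot (negPf zl) (negPf zh).
have mzh : mate D z != hi by rewrite okada_mate_eq // mhi.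
case: ifP => //; rewrite /foot (negPf mzh) orbF => /eqP E.
by rewrite -E okada_lab_mate.
Qed.
End Uncap.

(** Apart from its arc {w, hi}, the diagram uncap_diag i w D arises from D by
    moving the end w of an arc to lo (the map q sends nodes of the former to
    nodes of D).  This respects the order of the nodes except for those between w
    and hi, which the hypothesis between confines to arcs among themselves with
    larger labels.  In the application, such nodes occur only when w is the node M,
    and then lie on the vertical arcs of index above M.  The ends w and lo have
    the same parity of place by w_odd, so that okada_of_odd applies. *)
Section UncapOkada.
Variables (N : nat) (i : 'I_N.-1) (w : node N) (D : prediag N).
Local Notation lo := (foot_lo i).
Local Notation hi := (foot_hi i).
Hypothesis oD : okada_arc D.
Hypotheses (mlo : mate D lo = hi) (llo : lab D lo = i.+1).
Hypotheses (w_hi : pos w < pos hi) (w_odd : odd (pos w) = ~~ odd (pos hi)).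
Hypotheses (w_abs : i.+2 <= absn w) (w_lab : lab D w <= i.+1).
Hypothesis between : forall z, pos w < pos z < pos hi ->
  (pos w < pos (mate D z) < pos hi) && (i.+2 < lab D z).

Local Notation C := (uncap_diag i w D).
Let mK := okada_mateK oD.
Let mN := okada_mateN oD.
Let mhi : mate D hi = lo. Proof. by rewrite -mlo mK. Qed.

Let whi : w != hi. Proof. by apply: contraTneq w_hi => ->; rewrite ltnn. Qed.
Let wlo : w != lo.
Proof. by apply: contraTneq w_hi => ->; have [-> _] := pos_foot i; lia. Qed.

Let regular (z : node N) := (z != hi) && (z != w).
Let q (z : node N) := if z == lo then w else z.

Let C_hi : mate C hi = w. Proof. by rewrite uncap_mateE eqxx. Qed.
Let C_w : mate C w = hi. Proof. by rewrite uncap_mateE (negPf whi) eqxx. Qed.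

Let irregular z : ~~ regular z -> z = hi \/ z = w.
Proof. by rewrite negb_and !negbK => /orP[]/eqP; tauto. Qed.

Let reg_mate z : regular z -> [/\ regular (mate C z), mate D (q z) = q (mate C z),
  mate C (mate C z) = z & mate C z != z].
Proof.
move=> /andP[/negPf zh /negPf zw]; rewrite (uncap_mateE i w D z) zh zw /q.
have lw : lo == w = false by rewrite eq_sym (negPf wlo).
have lh := foot_lo_neq_hi i.
have wh : mate D w == hi = false by rewrite okada_mate_eq // mhi (negPf wlo).
have wl : mate D w == lo = false by rewrite okada_mate_eq // mlo (negPf whi).
have ww := negPf (mN w).
have [->|zl] := eqVneq z lo.
  by rewrite /regular wh wl ww uncap_mateE wh ww wl mK eqxx.
have [E|/negPf mzw] := eqVneq (mate D z) w.
  have -> : z = mate D w by rewrite -E mK.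
  by rewrite /regular lh lw eqxx uncap_mateE lh lw eqxx mK eq_sym wl.
have mzh : mate D z == hi = false by rewrite okada_mate_eq // mhi (negPf zl).
have mzl : mate D z == lo = false by rewrite okada_mate_eq // mlo zh.
rewrite /regular mzh mzw mzl uncap_mateE mzh mzw mzl mK zw.
by rewrite (mN z).
Qed.

Let reg_lab z : regular z -> lab C z = lab D (q z).
Proof.
by move=> /andP[/negPf zh /negPf zw]; rewrite uncap_labE zh zw /q; case: ifP.
Qed.

Let reg_pos z : regular z ->
  (pos z = (pos hi).+1 /\ pos (q z) = pos w) \/
  pos z <> pos hi /\ pos z <> pos w /\ pos z <> (pos hi).+1 /\ pos (q z) = pos z.
Proof.
have pE := @pos_inj N; have [lE _] := pos_foot i.
move=> /andP[/eqP zh /eqP zw]; rewrite /q; have [->|/eqP zl] := eqVneq z lo.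
  by left; rewrite lE.
by right; rewrite -lE; do !split=> //; move/pE.
Qed.

Let btw (z : node N) := pos w < pos z < pos hi.

Let reg_btw z : regular z -> btw (mate C z) = btw z.
Proof.
have half t : regular t -> btw t -> btw (mate C t).
  move=> rt; have [rmt Et _ _] := reg_mate rt; rewrite /btw => bt.
  have pt := reg_pos rt; have pmt := reg_pos rmt.
  have Eqt : pos (q t) = pos t by lia.
  have H : pos w < pos (q t) < pos hi by rewrite Eqt.
  by have := between H; rewrite Et; lia.
move=> rz; have [rmz _ mmz _] := reg_mate rz.
by apply/idP/idP => /half; rewrite ?mmz; apply.
Qed.

Let q_mono s t : regular s -> regular t -> btw s = btw t ->
  (pos (q s) < pos (q t)) = (pos s < pos t).
Proof.
by move=> /reg_pos ps /reg_pos pt; rewrite /btw; lia.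
Qed.

Lemma uncap_matching : matching C.
Proof.
apply/matchingP; split=> z; have [rz|/irregular[]->] := boolP (regular z).
- by case: (reg_mate rz).
- by rewrite C_hi C_w.
- by rewrite C_w C_hi.
- by case: (reg_mate rz).
- by rewrite C_hi.
by rewrite C_w eq_sym.
Qed.

Let q_id z : pos z != (pos hi).+1 -> q z = z.
Proof. by rewrite /q; have [->|//] := eqVneq z lo; rewrite (pos_foot i).1 eqxx. Qed.

Lemma uncap_noncrossing : noncrossing C.
Proof.
apply/forallP => a; apply/forallP => b; apply/negP => /and3P[ab bma mamb].
have [ra|/irregular[]Ea] := boolP (regular a); last 2 first.
- by rewrite Ea C_hi in ab bma mamb; lia.
- rewrite Ea C_w in ab bma mamb; have rb : regular b.
    by rewrite /regular; apply/andP; split; apply/eqP => E; rewrite E in ab bma; lia.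
  by have := reg_btw rb; rewrite /btw; lia.
have ba := reg_btw ra; have [rma Ea _ _] := reg_mate ra.
have [rb|/irregular[]Eb] := boolP (regular b); last 2 first.
- by rewrite Eb C_hi in ab bma mamb; lia.
- by rewrite Eb C_w in ab bma mamb; move: ba; rewrite /btw; lia.
have bb := reg_btw rb; have [rmb Eb _ _] := reg_mate rb.
have bab : btw a = btw b by move: ba bb; rewrite /btw; lia.
have /okadaP[_ /forallP/(_ (q a))/forallP/(_ (q b)) + _ _] := oD.
by rewrite Ea Eb !q_mono ?ab ?bma ?mamb // ?ba ?bb ?bab.
Qed.

Lemma uncap_lab_nested a b : nested C a b -> lab C b < lab C a.
Proof.
case/and3P => ba ama mamb; have [lE _] := pos_foot i.
have nest x y : nested D x y -> lab D y < lab D x.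
  by case/okadaP: oD => _ _ _; apply.
have lCw : lab C w = i.+2 by rewrite uncap_labE eqxx orbT.
have [ra|/irregular[]Ea] := boolP (regular a); last 2 first.
- by rewrite Ea C_hi in ama; lia.
- rewrite Ea C_w in ba ama mamb *; rewrite lCw.
  have rb : regular b.
    by rewrite /regular; apply/andP; split; apply/eqP => E; rewrite E in ba; lia.
  have [rmb Eb _ _] := reg_mate rb; rewrite (reg_lab rb).
  (* An arc {b, lo} of C stems from the arc {b, w} of D. *)
  have [mbl|mbl] := eqVneq (mate C b) lo.
    move: Eb; rewrite mbl {2}/q eqxx => /(congr1 (lab D)).
    by rewrite okada_lab_mate // => ->.
  (* Any other arc of C around {w, hi} is one of D around {hi, lo}. *)
  have mbl' : pos (mate C b) <> (pos hi).+1.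
    by rewrite -lE => /(@pos_inj N)/eqP; rewrite (negPf mbl).
  have lhi : lab D hi = i.+1 by rewrite -mlo okada_lab_mate.
  suff : lab D (q b) < lab D hi by rewrite lhi => /ltnW.
  apply: nest.
  have pb := reg_pos rb; have pmb := reg_pos rmb.
  by rewrite /nested mhi Eb lE; lia.
have aa := reg_btw ra; have [rma Ea _ _] := reg_mate ra; rewrite (reg_lab ra).
have [rb|/irregular[]Eb] := boolP (regular b); last 2 first.
- by rewrite Eb C_hi in ba ama mamb; lia.
- rewrite Eb C_w in ba ama mamb *; rewrite lCw q_id; last by lia.
  by have /andP[] : (pos w < pos (mate D a) < pos hi) && (i.+2 < lab D a);
    [apply: between; lia|].
have bb := reg_btw rb; have [rmb Eb _ _] := reg_mate rb; rewrite (reg_lab rb).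
have [bab|bab] := eqVneq (btw a) (btw b).
  by apply: nest; rewrite /nested Ea Eb !q_mono ?ba ?ama ?mamb // ?aa ?bb ?bab.
(* The remaining case: the arc of a lies between w and hi, that of b does not.
   Then q may fail to be monotone, namely if the arc of b ends at lo. *)
have [ba1 nbb] : btw a /\ ~~ btw b.
  clear nest lCw Ea Eb; move: bab bb aa; rewrite /btw.
  by case: (btw a) (btw b); lia.
have qa : q a = a.
  by apply: q_id; case/andP: ba1 => _; clear; lia.
have [Hm la] : pos w < pos (mate D a) < pos hi /\ i.+2 < lab D a.
  by apply/andP; apply: between.
rewrite qa in Ea *.
have [mbl|mbl] := eqVneq (mate C b) lo.
  move: Eb; rewrite mbl {2}/q eqxx => /(congr1 (lab D)).
  rewrite okada_lab_mate // => ->; apply: leq_ltn_trans w_lab _.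
  exact: ltn_trans la.
have mbl' : pos (mate C b) != (pos hi).+1 by rewrite -lE (inj_eq (@pos_inj N)).
have qb : q b = b.
  by apply: q_id; case/andP: ba1 => _; move: ba; clear; lia.
apply: nest; rewrite qb; rewrite qb (q_id mbl') in Eb.
have Em : mate D a = mate C a.
  rewrite Ea q_id //; move: aa; rewrite ba1 => /andP[_]; clear; lia.
by rewrite /nested Em Eb ba ama.
Qed.

Lemma uncap_okada : okada_arc C.
Proof.
have [lE hodd] := pos_foot i.
have wabs : absn hi = i.+2 by [].
apply: okada_of_odd.
- exact: uncap_matching.
- exact: uncap_noncrossing.
- move=> z; have [rz|/irregular[]->] := boolP (regular z).
  + have [rmz Ez _ _] := reg_mate rz; rewrite !reg_lab // -Ez okada_lab_mate //.
    split=> //; first exact: okada_lab_gt0.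
    by rewrite /q; have [->|_] := eqVneq z lo; last exact: okada_lab_le.
  + by rewrite C_hi !uncap_labE !eqxx orbT.
  + by rewrite C_w !uncap_labE !eqxx orbT; split.
- move=> z lz; have [rz|/irregular[]E] := boolP (regular z); last 2 first.
  + by rewrite E C_hi in lz; lia.
  + by rewrite E uncap_labE eqxx orbT w_odd hodd /= !negbK.
  have [rmz Ez _ _] := reg_mate rz; rewrite reg_lab //.
  have -> : odd (pos z) = odd (pos (q z)).
    by have [[-> ->]|[_ [_ [_ ->]]]] := reg_pos rz; rewrite //= w_odd.
  by apply: okada_lab_odd => //; rewrite Ez q_mono // reg_btw.
exact: uncap_lab_nested.
Qed.
End UncapOkada.

(** * Pockets: the place of the last short arc *)

Section Layers.
Variable N : nat.
Implicit Types (D : prediag N) (M : 'I_N).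

Definition vertical_from m D := forall z : node N, m <= z.2 ->
  mate D z = (~~ z.1, z.2) /\ lab D z = absn z.

(** The nodes M, bar M, bar (M-1), ..., bar 0 in their order, which the short
    arc traverses while the generators M - 1, M - 2, ... are multiplied on the
    right. *)
Definition slot M c : node N :=
  if c is c'.+1 then (true, insubd M (M - c')) else (false, M).

Lemma slot1 M c : (slot M c).1 = (0 < c). Proof. by case: c. Qed.

Lemma slot2 M c : (slot M c).2 = M - c.-1 :> nat.
Proof.
case: c => [|c] /=; rewrite ?subn0 // val_insubd; case: ifP => //.
by have := ltn_ord M; lia.
Qed.

Lemma slotP M c (z : node N) : z.1 = (0 < c) -> z.2 = M - c.-1 :> nat -> z = slot M c.
Proof.
move=> z1 z2; rewrite [z]surjective_pairing [slot M c]surjective_pairing slot1 z1.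
by congr (_, _); apply: val_inj; rewrite /= slot2.
Qed.

(** The shape of E * D(M, c) for E vertical from M on: the short arc is at place
    c with the largest label possible there, and an end of an arc at place
    j < c was at place j + 2 before being jumped over, where labels are at most
    M - j. *)
Definition pocket M c D := [/\ vertical_from M.+1 D,
  mate D (slot M c) = slot M c.+1, lab D (slot M c) = M.+1 - c
  & forall j, j < c -> lab D (slot M j) <= M - j].

Lemma pocket0 M D : okada_arc D -> pocket M 0 D <-> vertical_from M D.
Proof.
move=> oD; have s1 : slot M 1 = (true, M) by symmetry; apply: slotP; rewrite //= subn0.
rewrite /pocket s1 subn0; split=> [[V m l _] z|V].
  rewrite leq_eqVlt => /orP[/eqP zM|/V//].
  have {zM} zM : z.2 = M by apply: val_inj.
  case: z zM => [[] k] /= ->; last by rewrite m l.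
  split; first by rewrite -m okada_mateK.
  by have := okada_lab_mate oD (slot M 0); rewrite m l.
have [m l] := V (slot M 0) (leqnn M).
by split=> // z /ltnW; exact: V.
Qed.

Lemma vertical_mate m D z : okada_arc D -> vertical_from m D ->
  (m <= (mate D z).2) = (m <= z.2).
Proof.
move=> oD V; apply/idP/idP => H; have [E _] := V _ H; last by rewrite E.
by move: E; rewrite okada_mateK // => ->.
Qed.

(** Take the first place c whose label reaches M + 1 - c; the bound on labels
    leaves the next place as the only possible mate on the right.  If c > 0, a
    mate on the left would either be the preceding node, which contradicts the
    parity of labels, or enclose the preceding node, whose label would then have
    to be larger, against the minimality of c.
    If c = 0, the bound on labels excludes a mate on the left. *)
Lemma pocket_exists M D : okada_arc D -> vertical_from M.+1 D ->
  exists2 c, c <= M & pocket M c D.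
Proof.
move=> oD V.
have exP : exists j, M.+1 - j <= lab D (slot M j).
  by exists M; rewrite subSnn okada_lab_gt0.
case: (ex_minnP exP) => c lc cmin; exists c.
  by apply: cmin; rewrite subSnn okada_lab_gt0.
have cM : c <= M by apply: cmin; rewrite subSnn okada_lab_gt0.
have before j : j < c -> lab D (slot M j) <= M - j.
  move=> jc; rewrite leqNgt; apply/negP => H.
  have := cmin j; rewrite subSn; [lia|exact: ltnW (leq_trans jc cM)].
suff mc : mate D (slot M c) = slot M c.+1.
  split=> //; apply/eqP; rewrite eqn_leq lc andbT -okada_lab_mate // mc.
  by apply: leq_trans (okada_lab_le oD _) _; rewrite /absn slot2 /=; lia.
set p := slot M c in lc *; set m := mate D p.
have mM : m.2 <= M.
  have := vertical_mate p oD V; rewrite -/m slot2 !ltnNge leq_subr /= => /negbT.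
  by rewrite negbK.
have lm : lab D p <= absn m by rewrite -okada_lab_mate // okada_lab_le.
have mp : m != p by apply: okada_mateN.
have mK := okada_mateK oD.
have mN := ltn_ord M.
case: c @p @m cM lc lm mp mM before {cmin} => [|k] p m cM lc lm mp mM before.
  apply: slotP; last by move: lc lm; rewrite /absn /=; lia.
  case E: m.1 => //; move: mp; rewrite [m]surjective_pairing E; apply: contraNeq => _.
  by apply/eqP; congr (_, _); apply: val_inj; move: lc lm; rewrite /absn /=; lia.
have p2 : p.2 = M - k :> nat by rewrite slot2.
have /orP[pm|pm] := pos_neq mp; last first.
  apply: slotP => /=; last first.
    by move: pm lc lm; rewrite /absn /pos p2 /=; case: (m.1); lia.
  by move: pm; rewrite /pos p2 /=; case: (m.1) => //; lia.
(* From here on the mate m of p precedes p; q is the place before p. *)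
have lq := before k (ltnSn k); set q := slot M k in lq.
have posq : pos q = if k is 0 then nat_of_ord M else N.*2 - (M - k).+2.
  by rewrite /pos slot1 slot2; case: (k) cM => [|l] /=; lia.
have posp : pos p = N.*2 - (M - k).+1 by rewrite /pos slot1 slot2.
have qp : pos q < pos p by rewrite posq posp; case: (k) cM => //= *; lia.
have mq : m != q.
  apply/eqP => E; have mqp : mate D q = p by rewrite -E mK.
  have lqp : lab D q = lab D p by rewrite -mqp okada_lab_mate.
  have := okada_lab_odd oD (x := q); rewrite mqp qp => /(_ isT).
  (* The two bounds on the labels of p and q leave only M - k, which has the
     wrong parity for an arc with first end q. *)
  have -> : lab D q = M - k by move: lq lc; rewrite lqp; lia.
  by rewrite posq; case: (k) cM => /= [|l] *; lia.
have mq' : pos m < pos q.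
  have := pos_neq mq; case/orP => // H.
  move: pm H; rewrite posq posp; case: (k) => [|l] /=; last by lia.
  by rewrite {1 2}/pos; case: (m.1); lia.
exfalso.
have /okadaP[mD nc _ nest] := oD.
have mm : mate D m = p by rewrite mK.
have W := noncrossingW nc mq'; have W2 := noncrossingW2 mD nc mq'.
rewrite mm in W W2.
(* The arc of q, with first end x, is nested in the arc {m, p}. *)
pose x := if pos q < pos (mate D q) then q else mate D q.
have mqN : mate D q != q := okada_mateN oD q.
have mqm : mate D q != m.
  by rewrite okada_mate_eq // mm; apply: contraTneq qp => ->; rewrite ltnn.
have mqp : mate D q != p by rewrite okada_mate_eq // -/m eq_sym.
have nx : nested D x m.
  have := pos_neq mqN; have := pos_neq mqm; have := pos_neq mqp.
  have := W qp; have := W2 qp.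
  rewrite /nested /x mm; case: ifP => H; rewrite ?mK; lia.
have := nest _ _ nx; rewrite okada_lab_mate //.
have -> : lab D x = lab D q by rewrite /x; case: ifP => _; rewrite ?okada_lab_mate.
by move=> /(leq_ltn_trans lc); rewrite subSS ltnNge lq.
Qed.

(** The label at place c of a pocket there exceeds the bound that a pocket at a
    later place imposes. *)
Lemma pocket_le M c c' D : c' <= M ->
  pocket M c D -> pocket M c' D -> c' <= c.
Proof.
move=> cM [_ _ lc _] [_ _ _ before]; rewrite leqNgt; apply/negP => cc.
by have := before _ cc; rewrite lc; lia.
Qed.

Lemma pocket_uniq M c c' D : c <= M -> c' <= M ->
  pocket M c D -> pocket M c' D -> c = c'.
Proof.
move=> cM cM' P P'; apply/eqP; rewrite eqn_leq.
by rewrite (pocket_le cM P' P) (pocket_le cM' P P').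
Qed.

Section Move.
Variables (M : 'I_N) (c : nat) (i : 'I_N.-1).
Hypotheses (cM : c < M) (iE : i = M - c.+1 :> nat).

Lemma foot_lo_slot : foot_lo i = slot M c.+2.
Proof. by apply: slotP => //=; rewrite iE. Qed.

Lemma foot_hi_slot : foot_hi i = slot M c.+1.
Proof. by apply: slotP => //=; rewrite iE; lia. Qed.

Lemma slot_not_foot j : j <= c -> foot i (slot M j) = false.
Proof. by move=> jc; rewrite footE slot1 slot2; lia. Qed.

Lemma above_not_foot (z : node N) : M < z.2 -> foot i z = false.
Proof. by move=> Mz; rewrite footE; lia. Qed.

(** The feet of the generator are at the places c + 1 and c + 2, so the node at
    place c takes over the arc that ended at place c + 2.  The label of that arc
    is at most M - c, which is the additional bound required of a pocket at
    place c + 1. *)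
Lemma pocket_cap D : okada_arc D -> pocket M c D -> pocket M c.+1 (cap_diag i D).
Proof.
move=> oD [V m l before].
have mhi : mate D (foot_hi i) = slot M c by rewrite foot_hi_slot -m okada_mateK.
have flo : foot i (foot_lo i) by rewrite /foot eqxx.
have fhi : foot i (foot_hi i) by rewrite /foot eqxx orbT.
split=> [z Mz|||j].
- have [mz lz] := V z Mz; rewrite cap_mateE cap_labE above_not_foot // mz.
  by rewrite above_not_foot.
- by rewrite -foot_hi_slot -foot_lo_slot cap_mateE fhi other_foot_hi.
- by rewrite -foot_hi_slot cap_labE fhi iE; lia.
rewrite ltnS => jc; rewrite cap_labE slot_not_foot //; case: ifP => [_|mj].
  by rewrite geq_min (leq_trans (okada_lab_le oD _)) // /absn /= iE; lia.
apply: before; rewrite ltn_neqAle jc andbT; apply: contraFneq mj => ->.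
by rewrite m -foot_hi_slot.
Qed.

Lemma pocket_uncap D : okada_arc D -> pocket M c.+1 D ->
  let C := uncap_diag i (slot M c) D in
  [/\ okada_arc C, pocket M c C & cap_diag i C = D].
Proof.
move=> oD [V m l before] C.
have hi_lo : mate D (foot_hi i) = foot_lo i by rewrite foot_hi_slot foot_lo_slot.
have lo_hi : mate D (foot_lo i) = foot_hi i by rewrite -hi_lo okada_mateK.
have llo : lab D (foot_lo i) = i.+1.
  by rewrite -hi_lo okada_lab_mate // foot_hi_slot l iE; lia.
have lw : lab D (slot M c) <= i.+1.
  by apply: leq_trans (before c _) _ => //; rewrite iE; lia.
have wf := slot_not_foot (leqnn c); have := wf => /norP[wlo whi].
have MN := ltn_ord M.
have pw : pos (slot M c) = if c is 0 then nat_of_ord M else N.*2 - (M - c).+2.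
  by rewrite /pos slot1 slot2; case: (c) cM => [|k] /=; lia.
have ph : pos (foot_hi i) = N.*2 - (M - c).+1 by rewrite /pos /= iE; lia.
have oC : okada_arc C.
  apply: uncap_okada; rewrite // ?pw ?ph.
  - by case: (c) cM => [|k] /=; lia.
  - by case: (c) cM => [|k] /=; lia.
  - by rewrite /absn slot2 iE; lia.
  move=> z Hz.
  have [c0 Mz] : c = 0 /\ M < z.2.
    move: Hz; rewrite /pos; have := ltn_ord z.2.
    by case: (z.1); case: (c) cM => [|k] /=; lia.
  have [-> ->] := V z Mz; move: Hz; rewrite c0 /pos /absn /= iE c0.
  by have := ltn_ord z.2; case: (z.1) => /=; lia.
split=> //; last exact: uncapK.
have whi' := negPf whi; have wlo' := negPf wlo.
split=> [z Mz|||j jc].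
- have [mz lz] := V z Mz; have := above_not_foot Mz => /norP[/negPf zl /negPf zh].
  have zw : (z == slot M c) = false.
    by apply: contraTF Mz => /eqP->; rewrite slot2 -leqNgt leq_subr.
  have mzw : (mate D z == slot M c) = false.
    apply: contraTF Mz => /eqP; rewrite mz => E.
    by rewrite -[z.2]/((~~ z.1, z.2).2) E slot2 -leqNgt leq_subr.
  by rewrite uncap_mateE uncap_labE zh zw zl mzw.
- by rewrite uncap_mateE whi' eqxx foot_hi_slot.
- by rewrite uncap_labE eqxx orbT iE; lia.
have := slot_not_foot (ltnW jc) => /norP[/negPf zl /negPf zh].
have zw : (slot M j == slot M c) = false.
  apply/negP => /eqP E; have := slot1 M j; have := slot2 M j; rewrite E slot1 slot2.
  by move: jc cM; clear; lia.
rewrite uncap_labE zh zw zl /=; apply: before; exact: ltnW.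
Qed.

Lemma pocket_cap_inj D D' : okada_arc D -> okada_arc D' ->
  pocket M c D -> pocket M c D' -> cap_diag i D = cap_diag i D' -> D = D'.
Proof.
have K E : okada_arc E -> pocket M c E -> uncap_diag i (slot M c) (cap_diag i E) = E.
  move=> oE [_ m l _]; have := slot_not_foot (leqnn c) => /norP[wlo whi].
  have mhi : mate E (foot_hi i) = slot M c by rewrite foot_hi_slot -m okada_mateK.
  by apply: capK => //; rewrite -okada_lab_mate // mhi l iE; lia.
by move=> oD oD' P P' E; rewrite -(K D) // E K.
Qed.
End Move.
End Layers.

(** * Diagrams as staircases *)

Section ArcNormal.
Variable N : nat.
Local Notation A := (gen_at (@arc_gen N)).
Implicit Types (M : 'I_N) (D E : arc_monoid N).

Lemma gen_at_ord (G : monoidType) (g : 'I_N.-1 -> G) (i : 'I_N.-1) :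
  gen_at g i = g i.
Proof. by rewrite /gen_at valK. Qed.

Lemma descent_step M c : c < M -> exists2 i : 'I_N.-1,
  i = M - c.+1 :> nat & forall E, (E * descent A M c.+1 =
    E * descent A M c * arc_gen i)%g.
Proof.
move=> cM; have MN := ltn_ord M; have iN : M - c.+1 < N.-1 by lia.
exists (Ordinal iN) => // E.
by rewrite descentS mulgA -(gen_at_ord (@arc_gen N) (Ordinal iN)).
Qed.

Lemma descent_pocket M c E : c <= M -> vertical_from M E ->
  pocket M c (E * descent A M c)%g.
Proof.
move=> cM V; elim: c cM => [|c IH] cM.
  by rewrite descent0 mulg1; apply/pocket0 => //; exact: arc_valP.
have [i iE step] := descent_step cM; rewrite step arc_mul_gen.
by apply: pocket_cap => //; [exact: arc_valP | apply: IH; exact: ltnW].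
Qed.

Lemma descent_inj M c E E' : c <= M -> vertical_from M E -> vertical_from M E' ->
  (E * descent A M c = E' * descent A M c)%g -> E = E'.
Proof.
move=> cM V V'; elim: c cM => [|c IH] cM; first by rewrite descent0 !mulg1.
have [i iE step] := descent_step cM.
rewrite (step E) (step E') => /(congr1 (@arc_val N)).
rewrite [LHS]arc_mul_gen [RHS]arc_mul_gen => eqC.
apply: IH; first exact: ltnW.
apply: val_inj; apply: (pocket_cap_inj cM iE) eqC; try exact: arc_valP.
  by apply: descent_pocket => //; exact: ltnW.
by apply: descent_pocket => //; exact: ltnW.
Qed.

(** Moving the short arc back to its initial place, one step at a time, undoes
    the row of generators. *)
Lemma pocket_factor M c D : c <= M -> pocket M c D ->
  exists2 E : arc_monoid N, vertical_from M E & D = (E * descent A M c)%g.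
Proof.
elim: c D => [|c IH] D cM P.
  exists D; last by rewrite descent0 mulg1.
  by apply/pocket0 => //; exact: arc_valP.
have [i iE step] := descent_step cM.
have [oC PC capC] := pocket_uncap cM iE (arc_valP D) P.
have [E VE eqC] := IH (Arc oC) (ltnW cM) PC.
by exists E => //; apply: val_inj; rewrite step [RHS]arc_mul_gen -eqC /= capC.
Qed.

Lemma vertical_one m : vertical_from m (1%g : arc_monoid N).
Proof. by move=> z _; rewrite /mate /lab !ffunE. Qed.

Lemma vertical_from0 D : vertical_from 0 D -> D = 1%g.
Proof.
move=> V; apply: val_inj; apply: prediag_eq => z; have [m l] := V z (leq0n _);
  have [m1 l1] := @vertical_one 0 z (leq0n _); by rewrite ?m ?l ?m1 ?l1.
Qed.

Lemma staircase_vertical c m : (forall i, c i <= i) -> m <= N ->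
  vertical_from m (staircase A c m).
Proof.
move=> cle; elim: m => [|m IH] mN.
  by rewrite /staircase big_ord0; exact: vertical_one.
rewrite staircaseS.
by have [] := @descent_pocket (Ordinal mN) (c m) _ (cle m) (IH (ltnW mN)).
Qed.

(** The pocket for the index m - 1 tells which row of generators to factor out;
    what remains is vertical from m - 1 on.  At index 0 only the identity is
    left. *)
Lemma vertical_staircase_form m D : m <= N -> vertical_from m D -> staircase_form A m D.
Proof.
elim: m D => [|m IH] D mN V.
  by rewrite (vertical_from0 V); exact: staircase_form1.
have [c cm P] := @pocket_exists _ (Ordinal mN) _ (arc_valP D) V.
have [E VE ->] := pocket_factor cm P.
by apply: staircase_formS => //; apply: IH => //; exact: ltnW.
Qed.

(** The length of the last row is the place of the unique pocket, and then that
    row can be cancelled. *)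
Lemma staircase_inj c c' m : (forall i, c i <= i) -> (forall i, c' i <= i) ->
  m <= N -> staircase A c m = staircase A c' m -> forall i, i < m -> c i = c' i.
Proof.
move=> cle cle'; elim: m => [|m IH] mN; first by [].
rewrite !staircaseS => E.
have V := staircase_vertical cle (ltnW mN).
have V' := staircase_vertical cle' (ltnW mN).
have cc : c m = c' m.
  apply: (@pocket_uniq _ (Ordinal mN) _ _
    (staircase A c m * descent A m (c m))%g) => //; first exact: descent_pocket.
  by rewrite E; exact: (@descent_pocket (Ordinal mN)).
move=> i; rewrite ltnS leq_eqVlt => /orP[/eqP->//|]; move: i; apply: IH.
  exact: ltnW.
by rewrite -cc in E; exact: (@descent_inj (Ordinal mN)) (cle m) V V' E.
Qed.

End ArcNormal.

(** * The isomorphism *)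

Section OkadaToArc.
Variable N : nat.

Lemma code_prodE (G : monoidType) (g : 'I_N.-1 -> G) (sigma : 'S_N)
    (c : nat -> nat) :
  (forall i : 'I_N, code sigma i = c i) ->
  code_prod g sigma = staircase (gen_at g) c N.
Proof. by move=> E; apply: eq_bigr => i _; rewrite E. Qed.

Lemma staircase_form_code_prod (G : monoidType) (g : 'I_N.-1 -> G) x :
  staircase_form (gen_at g) N x -> exists sigma, x = code_prod g sigma.
Proof.
case=> c cle ->; have [sigma E] := perm_of_code N cle.
by exists sigma; rewrite (code_prodE g E).
Qed.

Lemma okada_mulE (u v : seq 'I_N.-1) :
  (okada_class u * okada_class v = okada_class (u ++ v))%g.
Proof. exact: okada_mul_class. Qed.

Local Notation e := (gen_at (@okada_gen N)).

Lemma okada_gen_idem j : (e j * e j = e j)%g.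
Proof.
rewrite /gen_at; case: insub => [i|] /=; last exact: mulg1.
by rewrite okada_mulE; apply/okada_classP; exact: (Okada_rule [::] [::] (Okada_idem i)).
Qed.

Lemma okada_gen_comm i j : apart i j -> (e i * e j = e j * e i)%g.
Proof.
rewrite /gen_at; case: insubP => [k _ <-|_ _]; last by rewrite mul1g mulg1.
case: insubP => [l _ <-|_ _]; last by rewrite mul1g mulg1.
move=> kl; rewrite /= !okada_mulE; apply/okada_classP.
exact: (Okada_rule [::] [::] (Okada_comm kl)).
Qed.

Lemma okada_gen_braid j : j.+1 < N.-1 -> (e j.+1 * e j * e j.+1 = e j.+1)%g.
Proof.
move=> jN; rewrite (gen_at_ord _ (Ordinal jN)) (gen_at_ord _ (Ordinal (ltnW jN))).
rewrite (okada_mulE [:: _] [:: _]) (okada_mulE _ [:: _]); apply/okada_classP.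
exact: (Okada_rule [::] [::] (@Okada_braid N (Ordinal (ltnW jN)) (Ordinal jN) erefl)).
Qed.

(** Staircases contain 1 and are stable under right multiplication by
    generators. *)
Lemma okada_staircase_form x : staircase_form e N x.
Proof.
have [w ->] := okada_class_surj x; elim/last_ind: w => [|w i IH].
  exact: staircase_form1.
rewrite -cats1 -okada_mulE -[okada_class [:: i]](gen_at_ord (@okada_gen N)).
apply: (@staircase_form_mul _ _ N.-1) => //.
- exact: okada_gen_idem.
- exact: okada_gen_comm.
- exact: okada_gen_braid.
by have := ltn_ord i; lia.
Qed.

Definition arc_word (w : seq 'I_N.-1) : arc_monoid N := (\prod_(i <- w) arc_gen i)%g.

Lemma arc_word_cat u v : arc_word (u ++ v) = (arc_word u * arc_word v)%g.
Proof. exact: big_cat. Qed.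

Lemma arc_word_cong u v : okada_cong u v -> arc_word u = arc_word v.
Proof.
elim=> {u v} [w w' u v uv|//|u v _ -> //|u v w _ -> _ ->//].
rewrite (arc_word_cat w (u ++ w')) (arc_word_cat w (v ++ w')).
rewrite (arc_word_cat u) (arc_word_cat v).
suff -> : arc_word u = arc_word v by [].
rewrite /arc_word.
case: uv => [i|i j ij|i j ji]; rewrite !big_cons !big_nil !mulg1.
- exact: arc_gen_idem.
- exact: arc_gen_comm.
by rewrite mulgA; exact: arc_gen_braid.
Qed.

(** The morphism with e_i |-> A_i; it does not depend on the representative by
    arc_word_cong. *)
Definition okada_arc_map (x : okada_monoid N) : arc_monoid N := arc_word (repr x).

Lemma okada_arc_map_class w : okada_arc_map (okada_class w) = arc_word w.
Proof.
by apply: arc_word_cong; apply/okada_classP; rewrite /okada_class reprK.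
Qed.

Lemma okada_arc_map_morph : monoid_morphism okada_arc_map.
Proof.
split; first by rewrite okada_arc_map_class /arc_word big_nil.
move=> x y; have [u ->] := okada_class_surj x; have [v ->] := okada_class_surj y.
by rewrite okada_mulE !okada_arc_map_class arc_word_cat.
Qed.

Lemma okada_arc_map_gen i : okada_arc_map (okada_gen i) = arc_gen i.
Proof. by rewrite okada_arc_map_class /arc_word big_seq1. Qed.

Lemma morph_descent (G H : monoidType) (f : G -> H) g h m r :
  monoid_morphism f -> (forall i : 'I_N.-1, f (g i) = h i) ->
  f (descent (gen_at g) m r) = descent (gen_at h) m r.
Proof.
move=> [f1 fM] fg; rewrite /descent (big_morph f fM f1); apply: eq_bigr => k _.
by rewrite /gen_at; case: insub.
Qed.

Lemma okada_arc_map_staircase c m :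
  okada_arc_map (staircase e c m) = staircase (gen_at (@arc_gen N)) c m.
Proof.
have [f1 fM] := okada_arc_map_morph.
rewrite /staircase (big_morph okada_arc_map fM f1); apply: eq_bigr => i _.
exact: morph_descent okada_arc_map_morph okada_arc_map_gen.
Qed.

(** The morphism sends staircases to staircases of the same sequence; every
    element on either side is a staircase, and diagrams determine the
    sequence. *)
Lemma okada_arc_map_bij : bijective okada_arc_map.
Proof.
have inj : injective okada_arc_map.
  move=> x y; have [c cle ->] := okada_staircase_form x.
  have [c' cle' ->] := okada_staircase_form y; rewrite !okada_arc_map_staircase.
  by move/(staircase_inj cle cle' (leqnn N)) => E; apply: eq_staircase.
have surj D : exists x, okada_arc_map x == D.
  have [c _ ->] : staircase_form (gen_at (@arc_gen N)) N D.
    by apply: vertical_staircase_form => // z; rewrite leqNgt ltn_ord.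
  by exists (staircase e c N); rewrite okada_arc_map_staircase.
exists (fun D => xchoose (surj D)) => [x|D]; last exact: (eqP (xchooseP (surj D))).
by apply: inj; exact: (eqP (xchooseP (surj _))).
Qed.
End OkadaToArc.

Theorem corollary3p61 (N : nat) :
  (exists! Theta : okada_monoid N -> arc_monoid N,
     forall sigma : 'S_N,
       Theta (code_prod (@okada_gen N) sigma) = code_prod (@arc_gen N) sigma)
  /\
  (forall Theta : okada_monoid N -> arc_monoid N,
     (forall sigma : 'S_N,
        Theta (code_prod (@okada_gen N) sigma) = code_prod (@arc_gen N) sigma) ->
     [/\ monoid_morphism Theta,
         bijective Theta
       & forall i : 'I_N.-1, Theta (okada_gen i) = arc_gen i]).
Proof.
have mapP (sigma : 'S_N) :
    okada_arc_map (code_prod (@okada_gen N) sigma) = code_prod (@arc_gen N) sigma.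
  pose c j := oapp (code sigma) 0 (insub j).
  have cE (i : 'I_N) : code sigma i = c i by rewrite /c valK.
  rewrite (code_prodE _ cE) (code_prodE _ cE).
  exact: okada_arc_map_staircase.
have uniq_map Theta : (forall sigma : 'S_N, Theta (code_prod (@okada_gen N) sigma)
    = code_prod (@arc_gen N) sigma) -> Theta = @okada_arc_map N.
  move=> H; apply: boolp.funext => x.
  have [sigma ->] := staircase_form_code_prod (okada_staircase_form x).
  by rewrite H mapP.
split; first by exists (@okada_arc_map N); split=> // Theta /uniq_map.
move=> Theta /uniq_map ->; split.
- exact: okada_arc_map_morph.
- exact: okada_arc_map_bij.
exact: okada_arc_map_gen.
Qed.
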